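(* Fix an integer $s\ge 0$. For all integers $k\ge 0$ and $n\ge 1$ define $\theta^{n,k,s}\in\mathbb{Q}V_{\mathrm{loopless}}^{n,k,s}$ by the following recursion: (i) $\theta^{1,0,s}$ is the graph consisting of a single vertex with $s$ external edges whose free ends are labeled $x_1,\dots,x_s$, with coefficient $1$ (and $\theta^{1,k,s}=0$ for $k>0$, since $V_{\mathrm{loopless}}^{1,k,s}=\emptyset$); (ii) for $n>1$, $$\theta^{n,k,s}:=\frac{1}{k+n-1}\left(\sum_{i=1}^{n-1}q_i^{(1)}(\theta^{n-1,k,s})+\sum_{i=1}^{n}\sum_{j=1}^{i-1}l^a_{i,j}(\theta^{n,k-1,s})\right),$$ where the $l^a_{i,j}$ summand does not appear when $k=0$. Then, for all fixed $n$ and $k$, $\theta^{n,k,s}=\sum_{G\in V_{\mathrm{loopless}}^{n,k,s}}\alpha_G\,G$ with $\alpha_G\in\mathbb{Q}$ and $\alpha_G>0$ for all $G\in V_{\mathrm{loopless}}^{n,k,s}$. Moreover, for every isomorphism class $\mathscr{C}\subseteq V_{\mathrm{loopless}}^{n,k,s}$, $$\sum_{G\in\mathscr{C}}\alpha_G=\frac{1}{S^{\mathscr{C}}},$$ where $S^{\mathscr{C}}$ denotes the symmetry factor of the graphs in $\mathscr{C}$.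
   Context: Graphs. A graph consists of a finite nonempty set $V$ of vertices, a finite set $K$ of ends of edges, and a partition $E$ of $K$ into two-element subsets, called edges; $E=E_{\mathrm{int}}\sqcup E_{\mathrm{ext}}$. Each end of an internal edge (element of $E_{\mathrm{int}}$) is assigned to a vertex; for each external edge (element of $E_{\mathrm{ext}}$) one end is assigned to a vertex and the other end is free. If there are $s$ external edges, their free ends carry distinct labels $x_1,\dots,x_s$. An internal edge with both ends assigned to the same vertex is a loop; a graph is loopless if it has no loops (multiple edges are allowed). A graph is connected if any two distinct vertices are joined by a path of internal edges (a single vertex is connected). The cyclomatic number is $k=m-n+c$, where $m=|E_{\mathrm{int}}|$, $n=|V|$ and $c$ is the number of connected components. Isomorphisms. An isomorphism of graphs is a pair of bijections $\psi_V:V\to V^*$, $\psi_K:K\to K^*$ that maps internal edges to internal edges and external edges to external edges, respects the assignment of ends to vertices (and free ends), and preserves the labels of the external edges. The symmetry factor $S^G$ is the order of the group of automorphisms $(\psi_V,\psi_K)$ of $G$; it is constant on isomorphism classes. Sets of graphs. $V^{n,k,s}$ is the set of all graphs with vertex set $\{v_1,\dots,v_n\}$, cyclomatic number $k$, and $s$ external edges whose free ends are labeled $x_1,\dots,x_s$; the vertices are ordered (labeled), while graphs that differ only by renaming the ends of edges (i.e. that are isomorphic via some $(\psi_V,\psi_K)$ with $\psi_V=\mathrm{id}$) are identified. $V_{\mathrm{loopless}}^{n,k,s}\subseteq V^{n,k,s}$ is the subset of loopless connected graphs. An isomorphism class $\mathscr{C}\subseteq V_{\mathrm{loopless}}^{n,k,s}$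 is an equivalence class under isomorphism, where $\psi_V$ may permute $v_1,\dots,v_n$. For a set $W$, $\mathbb{Q}W$ is the free $\mathbb{Q}$-vector space on $W$. Linear maps, defined on graphs $G\in V^{n,k,s}$ and extended linearly: - $l_{i,j}(G)$, $i\ne j$, is $G$ with one additional internal edge joining $v_i$ and $v_j$. - $l^a_{i,j}(G)$, $i\ne j$, equals $l_{i,j}(G)$ if at least one internal edge of $G$ joins $v_i$ and $v_j$, and equals $0$ otherwise. - $s_i(G)$, $1\le i\le n$: let $\mathcal{E}_i$ be the set of all ends (of internal and external edges) assigned to $v_i$. Then $s_i(G)=\sum G_{(\mathcal{E}^{(1)},\mathcal{E}^{(2)})}$, the sum being over all ordered pairs of disjoint, possibly empty sets with $\mathcal{E}^{(1)}\cup\mathcal{E}^{(2)}=\mathcal{E}_i$, where $G_{(\mathcal{E}^{(1)},\mathcal{E}^{(2)})}$ is obtained from $G$ by adding a new vertex $v_{n+1}$, keeping the ends in $\mathcal{E}^{(1)}$ at $v_i$, and reassigning the ends in $\mathcal{E}^{(2)}$ to $v_{n+1}$. - $q_i^{(1)}:=\frac12\, l_{i,n+1}\circ s_i$. *)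

(* Defs.v *)
From HB Require Import structures.
From mathcomp Require Import all_boot all_order all_algebra all_fingroup.
From mathcomp Require Import generic_quotient finmap.
From mathcomp Require Import monalg.

Set Implicit Arguments.
Unset Strict Implicit.
Unset Printing Implicit Defensive.

Import GRing.Theory Num.Theory.
Local Open Scope ring_scope.
Local Open Scope quotient_scope.

(* [int_edges] and [ext_edges] are the internal and the external edges, as    *)
(* two-element sets of ends; [vtx x] is the vertex to which the end [x] is    *)
(* assigned, or [None] when [x] is free; [lab j] is the free end labeled      *)
(* x_(j+1).                                                                   *)
Record graph_data (V K : finType) (s : nat) := GraphData {
  int_edges : {set {set K}};
  ext_edges : {set {set K}};
  vtx : {ffun K -> option V};
  lab : {ffun 'I_s -> K} }.

Section GraphDataFinite.
Variables (V K : finType) (s : nat).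

Definition tuple_of_data (D : graph_data V K s) :=
  (int_edges D, ext_edges D, vtx D, lab D).
Definition data_of_tuple
    (t : {set {set K}} * {set {set K}} * {ffun K -> option V}
         * {ffun 'I_s -> K}) : graph_data V K s :=
  let: (a, b, c, d) := t in GraphData a b c d.
Lemma tuple_of_dataK : cancel tuple_of_data data_of_tuple.
Proof. by case. Qed.

HB.instance Definition _ := Finite.copy (graph_data V K s) (can_type tuple_of_dataK).
End GraphDataFinite.

(* The last two conditions say that [lab] is a bijection onto the free ends;  *)
(* as each external edge has exactly one of them, #|ext_edges D| = s.         *)
Definition graph_wf (V K : finType) (s : nat) (D : graph_data V K s) : bool :=
  [&& (0 < #|V|)%N,
      partition (int_edges D :|: ext_edges D) [set: K],
      [disjoint int_edges D & ext_edges D],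
      [forall e in int_edges D :|: ext_edges D, #|e| == 2%N],
      [forall e in int_edges D, forall x in e, vtx D x != None],
      [forall e in ext_edges D, #|[set x in e | vtx D x == None]| == 1%N],
      injectiveb (lab D) &
      [forall x, (vtx D x == None) == (x \in codom (lab D))]].

Record graph (V K : finType) (s : nat) := Graph {
  gdata :> graph_data V K s;
  gdata_wf : graph_wf gdata }.

HB.instance Definition _ V K s := [isSub for @gdata V K s].
HB.instance Definition _ V K s := [Finite of graph V K s by <:].

Definition bijectiveb (A B : finType) (f : A -> B) : bool :=
  [exists g : {ffun B -> A},
     [forall x, g (f x) == x] && [forall y, f (g y) == y]].

Lemma bijectiveP (A B : finType) (f : A -> B) :
  reflect (bijective f) (bijectiveb f).
Proof.
apply: (iffP existsP) => [[g /andP[/forallP fK /forallP gK]]|[g fK gK]].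
  by exists g => x; apply/eqP.
exists (finfun g); apply/andP; split; apply/forallP => x; rewrite ffunE.
  by rewrite fK.
by rewrite gK.
Qed.

Section Isomorphism.
Variables (V K V' K' : finType) (s : nat).

Definition is_iso (psiV : V -> V') (psiK : K -> K')
    (G : graph V K s) (G' : graph V' K' s) : bool :=
  [&& bijectiveb psiV,
      bijectiveb psiK,
      [forall e : {set K}, (psiK @: e \in int_edges G') == (e \in int_edges G)],
      [forall e : {set K}, (psiK @: e \in ext_edges G') == (e \in ext_edges G)],
      [forall x, vtx G' (psiK x) == omap psiV (vtx G x)] &
      [forall j, lab G' j == psiK (lab G j)]].

Definition isomorphic (G : graph V K s) (G' : graph V' K' s) : bool :=
  [exists psiV : {ffun V -> V'}, exists psiK : {ffun K -> K'},
     is_iso psiV psiK G G'].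
End Isomorphism.

Definition end_isomorphic (V K K' : finType) s
    (G : graph V K s) (G' : graph V K' s) : bool :=
  [exists psiK : {ffun K -> K'}, is_iso id psiK G G'].

Definition automorphisms (V K : finType) s (G : graph V K s) :
    {set {perm V} * {perm K}} :=
  [set p : {perm V} * {perm K} | is_iso p.1 p.2 G G].

Section IsoTheory.
Variable s : nat.

Lemma is_iso_id (V K : finType) (G : graph V K s) : is_iso id id G G.
Proof.
apply/andP; split; last (apply/and5P; split).
- by apply/bijectiveP; exists id.
- by apply/bijectiveP; exists id.
- by apply/forallP => e; rewrite imset_id.
- by apply/forallP => e; rewrite imset_id.
- by apply/forallP => x; rewrite omap_id.
- by apply/forallP => j.
Qed.

Lemma is_iso_comp (V K V' K' V'' K'' : finType) (G : graph V K s)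
    (G' : graph V' K' s) (G'' : graph V'' K'' s) f g f' g' :
  is_iso f g G G' -> is_iso f' g' G' G'' -> is_iso (f' \o f) (g' \o g) G G''.
Proof.
case/andP=> /bijectiveP bf /and5P[/bijectiveP bg /forallP gi /forallP ge
  /forallP fv /forallP gl].
case/andP=> /bijectiveP bf' /and5P[/bijectiveP bg' /forallP gi' /forallP ge'
  /forallP fv' /forallP gl'].
apply/andP; split; last (apply/and5P; split).
- by apply/bijectiveP; apply: bij_comp.
- by apply/bijectiveP; apply: bij_comp.
- by apply/forallP => e; rewrite imset_comp (eqP (gi' _)) (eqP (gi _)).
- by apply/forallP => e; rewrite imset_comp (eqP (ge' _)) (eqP (ge _)).
- apply/forallP => x /=; rewrite (eqP (fv' _)) (eqP (fv _)).
  by case: (vtx G x).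
- by apply/forallP => j; rewrite /= (eqP (gl' _)) (eqP (gl _)).
Qed.

Lemma is_iso_inv (V K V' K' : finType) (G : graph V K s) (G' : graph V' K' s)
    f f' g g' :
  cancel f f' -> cancel f' f -> cancel g g' -> cancel g' g ->
  is_iso f g G G' -> is_iso f' g' G' G.
Proof.
move=> fK fK' gK gK'; case/andP=> _ /and5P[_ /forallP gi /forallP ge
  /forallP fv /forallP gl].
have gKs (e : {set K'}) : g @: (g' @: e) = e.
  by rewrite -imset_comp (eq_imset _ (gK' : g \o g' =1 id)) imset_id.
apply/andP; split; last (apply/and5P; split).
- by apply/bijectiveP; exists f.
- by apply/bijectiveP; exists g.
- by apply/forallP => e; rewrite -(eqP (gi _)) gKs.
- by apply/forallP => e; rewrite -(eqP (ge _)) gKs.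
- apply/forallP => x; rewrite -{2}[x]gK' (eqP (fv _)).
  by case: (vtx G _) => //= v; rewrite fK.
- by apply/forallP => j; rewrite (eqP (gl _)) gK.
Qed.

Lemma eq_is_iso (V K V' K' : finType) (G : graph V K s) (G' : graph V' K' s)
    f f' g g' : f =1 f' -> g =1 g' -> is_iso f g G G' = is_iso f' g' G G'.
Proof.
move=> ef eg.
have imp h h' k k' : h =1 h' -> k =1 k' -> is_iso h k G G' -> is_iso h' k' G G'.
  move=> eh ek; case/andP=> /bijectiveP bf /and5P[/bijectiveP bg /forallP gi
    /forallP ge /forallP fv /forallP gl].
  apply/andP; split; last (apply/and5P; split).
  - exact/bijectiveP/(eq_bij bf).
  - exact/bijectiveP/(eq_bij bg).
  - by apply/forallP => e; rewrite -(eq_imset _ ek).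
  - by apply/forallP => e; rewrite -(eq_imset _ ek).
  - by apply/forallP => x; rewrite -ek (eqP (fv x)) (eq_omap eh).
  - by apply/forallP => j; rewrite -ek.
by apply/idP/idP; apply: imp => // x.
Qed.

Lemma automorphisms_group_set (V K : finType) (G : graph V K s) :
  group_set (automorphisms G).
Proof.
apply/group_setP; split => [|[p q] [p' q']].
  rewrite inE /= (@eq_is_iso _ _ _ _ G G _ id _ id) ?is_iso_id // => x;
  exact: perm1.
rewrite !inE /= => i i'.
rewrite (@eq_is_iso _ _ _ _ G G _ (p' \o p) _ (q' \o q)) ?(is_iso_comp i i') //.
- by move=> x; rewrite permM.
- by move=> x; rewrite permM.
Qed.

Canonical automorphism_group (V K : finType) (G : graph V K s) :=
  Group (automorphisms_group_set G).

Lemma isomorphicP (V K V' K' : finType) (G : graph V K s) (G' : graph V' K' s) :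
  reflect (exists f, exists g, is_iso f g G G') (isomorphic G G').
Proof.
apply: (iffP existsP) => [[f /existsP[g i]]|[f [g i]]].
  by exists f, g.
exists (finfun f); apply/existsP; exists (finfun g).
by rewrite (@eq_is_iso _ _ _ _ _ _ _ f _ g) // => x; rewrite ffunE.
Qed.

Lemma end_isomorphicP (V K K' : finType) (G : graph V K s) (G' : graph V K' s) :
  reflect (exists g, is_iso id g G G') (end_isomorphic G G').
Proof.
apply: (iffP existsP) => [[g i]|[g i]].
  by exists g.
exists (finfun g).
by rewrite (@eq_is_iso _ _ _ _ _ _ _ id _ g) // => x; rewrite ffunE.
Qed.
End IsoTheory.

Section Predicates.
Variables (V K : finType) (s : nat) (G : graph V K s).

Definition joins (e : {set K}) (u v : V) : bool :=
  vtx G @: e == [set Some u; Some v].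

Definition adjacent : rel V := fun u v => [exists e in int_edges G, joins e u v].

Definition is_loopless : bool :=
  [forall e in int_edges G, forall v, ~~ joins e v v].

Definition is_connected : bool :=
  [forall u, forall v, connect adjacent u v].

Definition cyclomatic : int :=
  #|int_edges G|%:Z - #|V|%:Z + (n_comp adjacent predT)%:Z.

Definition ends_at (v : V) : {set K} := [set x | vtx G x == Some v].
End Predicates.

Lemma partition_setT (K : finType) (P : {set {set K}}) :
  set0 \notin P ->
  (forall x, exists2 A, A \in P & x \in A) ->
  (forall A B x, A \in P -> B \in P -> x \in A -> x \in B -> A = B) ->
  partition P [set: K].
Proof.
move=> P0 Pc Pt; apply/and3P; split=> //.
  apply/eqP/setP => x; rewrite inE; have [A AP xA] := Pc x.
  by apply/bigcupP; exists A.
apply/trivIsetP => A B AP BP /eqP neAB.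
rewrite disjoint_subset; apply/subsetP => x xA; rewrite inE.
by apply/negP => xB; case: neAB; apply: Pt xA xB.
Qed.

Section Point.
Variable s : nat.

Definition point_data : graph_data 'I_1 'I_(s + s) s := {|
  int_edges := set0;
  ext_edges := [set [set lshift s j; rshift s j] | j : 'I_s];
  vtx := [ffun x => if split x is inl _ then Some ord0 else None];
  lab := [ffun j => rshift s j] |}.

Lemma point_wf : graph_wf point_data.
Proof.
have vl j : vtx point_data (lshift s j) = Some ord0.
  by rewrite ffunE -[lshift s j]/(unsplit (inl j)) unsplitK.
have vr j : vtx point_data (rshift s j) = None.
  by rewrite ffunE -[rshift s j]/(unsplit (inr j)) unsplitK.
rewrite /graph_wf; apply/andP; split; first by rewrite card_ord.
rewrite /= set0U; apply/and5P; split.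
- apply: partition_setT.
  + apply/imsetP => -[j _ /setP/(_ (lshift s j))].
    by rewrite !inE eqxx.
  + move=> x; case: (split_ordP x) => j ->.
      by exists [set lshift s j; rshift s j]; [apply: imset_f | rewrite set21].
    by exists [set lshift s j; rshift s j]; [apply: imset_f | rewrite set22].
  + move=> A B x /imsetP[i _ ->] /imsetP[j _ ->].
    rewrite !inE; case: (split_ordP x) => h ->.
      rewrite !eq_lshift !eq_lrshift !orbF => /eqP <- /eqP <- //.
    by rewrite !eq_rshift !eq_rlshift /= => /eqP <- /eqP <-.
- by rewrite disjoint_subset; apply/subsetP => x; rewrite inE.
- apply/forall_inP => e /imsetP[j _ ->].
  by rewrite cards2 eq_lrshift.
- by apply/forall_inP => e; rewrite inE.
apply/and3P; split.
- apply/forall_inP => e /imsetP[j _ ->]; apply/cards1P; exists (rshift s j).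
  apply/setP => x; rewrite !inE; case: (split_ordP x) => h ->.
    by rewrite vl eq_lrshift andbF.
  by rewrite vr eq_rlshift eqxx andbT.
- by apply/injectiveP => i j; rewrite !ffunE => /rshift_inj.
- apply/forallP => x; apply/eqP; case: (split_ordP x) => h ->.
    rewrite vl; apply/esym/negbTE/codomP => -[j]; rewrite ffunE => /eqP.
    by rewrite eq_lrshift.
  by rewrite vr eqxx; apply/esym/codomP; exists h; rewrite ffunE.
Qed.

Definition point_graph := Graph point_wf.
End Point.

(* The ends of [G] are shifted by [lshift]; the two new ends are [rshift e]   *)
(* of 0 and 1.                                                                *)
Section AddEdge.
Variables (V : finType) (e s : nat) (i j : V) (G : graph V 'I_e s).

Definition old_end (x : 'I_e) : 'I_(e + 2) := lshift 2 x.
Definition new_end (b : 'I_2) : 'I_(e + 2) := rshift e b.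

Definition add_edge_data : graph_data V 'I_(e + 2) s := {|
  int_edges := [set new_end ord0; new_end ord_max]
           |: [set old_end @: (a : {set _}) | a in int_edges G];
  ext_edges := [set old_end @: (a : {set _}) | a in ext_edges G];
  vtx := [ffun x => match split x with
                    | inl y => vtx G y
                    | inr b => Some (if b == ord0 then i else j)
                    end];
  lab := [ffun l => old_end (lab G l)] |}.

Lemma add_edge_wf : graph_wf add_edge_data.
Proof.
have vl x : vtx add_edge_data (old_end x) = vtx G x.
  by rewrite ffunE -[old_end x]/(unsplit (inl x)) unsplitK.
have vr b : vtx add_edge_data (new_end b) != None.
  by rewrite ffunE -[new_end b]/(unsplit (inr b)) unsplitK.
have oinj : injective old_end by exact: lshift_inj.
have mo x (a : {set 'I_e}) : (old_end x \in old_end @: a) = (x \in a).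
  exact: mem_imset.
have mn b (a : {set 'I_e}) : (new_end b \in old_end @: a) = false.
  by apply/negP => /imsetP[x _ /eqP]; rewrite eq_rlshift.
have new2 b : new_end b \in [set new_end ord0; new_end ord_max].
  by rewrite !inE !eq_rshift; case: b => [[|[|]]].
have old2 x : old_end x \notin [set new_end ord0; new_end ord_max].
  by rewrite !inE !eq_lrshift.
have := gdata_wf G; rewrite /graph_wf => /andP[V0].
case/and5P=> /and3P[/eqP cG tG n0] dG /forall_inP c2 /forall_inP fi.
case/and3P=> /forall_inP fe /injectiveP linj /forallP lc.
apply/andP; split=> //.
have eE : int_edges add_edge_data :|: ext_edges add_edge_data =
    [set new_end ord0; new_end ord_max]
      |: [set old_end @: (a : {set _}) | a in int_edges G :|: ext_edges G].
  by rewrite imsetU /= setUA.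
rewrite eE; apply/and5P; split.
- apply: partition_setT.
  + rewrite !inE negb_or; apply/andP; split.
      by apply/eqP => /setP/(_ (new_end ord0)); rewrite new2 inE.
    apply/imsetP => -[a aG /setP a0]; move: n0; rewrite (_ : set0 = a) ?aG //.
    by apply/setP => x; rewrite -[RHS]mo -a0 !inE.
  + move=> x; case: (split_ordP x) => y ->; last first.
      by exists [set new_end ord0; new_end ord_max]; [rewrite setU11 | apply: new2].
    have : y \in cover (int_edges G :|: ext_edges G) by rewrite cG inE.
    case/bigcupP=> a aG ya; exists (old_end @: a); last by rewrite mo.
    by rewrite in_setU1 imset_f ?orbT.
  + move=> A B x; rewrite !in_setU1.
    case/predU1P=> [->|/imsetP[a aG ->]]; case/predU1P=> [->|/imsetP[b bG ->]] //;
      case: (split_ordP x) => y ->.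
    * by rewrite (negbTE (old2 y)).
    * by rewrite (mn y b).
    * by rewrite (negbTE (old2 y)).
    * by rewrite (mn y a).
    * rewrite !mo => ya yb; congr (_ @: _).
      by rewrite -(def_pblock tG aG ya) -(def_pblock tG bG yb).
    * by rewrite (mn y a).
- rewrite disjoint_subset; apply/subsetP => A; rewrite !inE.
  case/predU1P=> [->|/imsetP[a aG ->]]; apply/imsetP => -[b bG].
    by move/setP/(_ (new_end ord0)); rewrite new2 mn.
  move/(imset_inj oinj) => ab; move/disjointFr: dG => /(_ _ aG).
  by rewrite ab bG.
- apply/forall_inP => A; rewrite in_setU1 => /predU1P[->|/imsetP[a aG ->]].
    by rewrite cards2 eq_rshift.
  by rewrite card_imset ?c2.
- apply/forall_inP => A; rewrite in_setU1 => /predU1P[->|/imsetP[a aG ->]].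
    by apply/forall_inP => x; rewrite !inE => /orP[] /eqP ->; apply: vr.
  apply/forall_inP => _ /imsetP[x xa ->]; rewrite vl.
  by have /forall_inP/(_ _ xa) := fi _ aG.
apply/and3P; split.
- apply/forall_inP => A /imsetP[a aG ->].
  move: (fe _ aG) => /eqP fea; apply/eqP; rewrite -[RHS]fea.
  rewrite -(card_imset _ oinj); apply: eq_card => x; rewrite inE.
  case: (split_ordP x) => y ->.
    by rewrite mo vl mo inE.
  by rewrite (mn y a) (mn y).
- by apply/injectiveP => k l; rewrite !ffunE => /oinj/linj.
- apply/forallP => x; apply/eqP; case: (split_ordP x) => y ->.
    rewrite vl (eqP (lc y)); apply/codomP/codomP => -[l].
      by move=> ->; exists l; rewrite ffunE.
    by rewrite ffunE => /oinj ->; exists l.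
  rewrite (negbTE (vr y)); apply/esym/negbTE/codomP => -[l].
  by rewrite ffunE => /eqP; rewrite eq_rlshift.
Qed.

Definition add_edge := Graph add_edge_wf.
End AddEdge.

(* The vertex v_(n+1) is [ord_max] and [old_vertex] is the inclusion of the   *)
(* vertices v_1, ..., v_n. The split reassigns the ends in [B] to v_(n+1); it *)
(* leaves free ends free, and is only used for [B] inside some [ends_at G i]. *)
Definition old_vertex (n : nat) (i : 'I_n) : 'I_n.+1 := widen_ord (leqnSn n) i.

Section Split.
Variables (n : nat) (K : finType) (s : nat) (B : {set K}) (G : graph 'I_n K s).

Definition split_data : graph_data 'I_n.+1 K s := {|
  int_edges := int_edges G;
  ext_edges := ext_edges G;
  vtx := [ffun x => omap (fun v => if x \in B then ord_max else old_vertex v)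
                         (vtx G x)];
  lab := lab G |}.

Lemma split_wf : graph_wf split_data.
Proof.
have vN x : (vtx split_data x == None) = (vtx G x == None).
  by rewrite ffunE; case: (vtx G x).
have := gdata_wf G; rewrite /graph_wf => /andP[_].
case/and5P=> pG dG c2 /forall_inP fi /and3P[/forall_inP fe linj /forallP lc].
rewrite card_ord /= pG dG c2 linj /=; apply/and3P; split.
- apply/forall_inP => e eG; apply/forall_inP => x xe; rewrite vN.
  by have /forall_inP/(_ _ xe) := fi _ eG.
- apply/forall_inP => e eG; rewrite -(eqP (fe _ eG)); apply/eqP.
  by apply: eq_card => x; rewrite !inE vN.
- by apply/forallP => x; rewrite vN.
Qed.

Definition split_graph := Graph split_wf.
End Split.

(* Graphs with vertex set {v_1, ..., v_n}, the ends being normalized to       *)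
(* {0, ..., e - 1}; renaming of ends is quotiented out in [vgraph].           *)
Definition pregraph (n s : nat) := {e : nat & graph 'I_n 'I_e s}.

Definition pregraph_of n s e (G : graph 'I_n 'I_e s) : pregraph n s :=
  Tagged (fun e => graph 'I_n 'I_e s) G.

Definition end_equiv n s : rel (pregraph n s) :=
  fun G H => end_isomorphic (tagged G) (tagged H).

Section EndEquiv.
Variables n s : nat.

Lemma end_equiv_refl : reflexive (@end_equiv n s).
Proof. by move=> G; apply/end_isomorphicP; exists id; apply: is_iso_id. Qed.

Lemma end_equiv_sym : symmetric (@end_equiv n s).
Proof.
have imp (G H : pregraph n s) : end_equiv G H -> end_equiv H G.
  case/end_isomorphicP=> g i; have /and3P[_ /bijectiveP[g' gK gK'] _] := i.
  by apply/end_isomorphicP; exists g'; apply: is_iso_inv i.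
by move=> G H; apply/idP/idP; apply: imp.
Qed.

Lemma end_equiv_trans : transitive (@end_equiv n s).
Proof.
move=> H G L /end_isomorphicP[g i] /end_isomorphicP[g' i'].
by apply/end_isomorphicP; exists (g' \o g); apply: is_iso_comp i i'.
Qed.

Canonical end_equiv_rel :=
  EquivRel (@end_equiv n s) end_equiv_refl end_equiv_sym end_equiv_trans.
End EndEquiv.

(* The union over k of the sets V^{n,k,s}. *)
Definition vgraph (n s : nat) := {eq_quot (@end_equiv n s)}.
HB.instance Definition _ n s := Choice.on (vgraph n s).

Section VGraph.
Variables n s : nat.

Definition vclass e (G : graph 'I_n 'I_e s) : vgraph n s :=
  \pi_(vgraph n s) (pregraph_of G).

Definition rep (G : vgraph n s) : graph 'I_n 'I_(tag (repr G)) s :=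
  tagged (repr G).

Definition Vgraphs (k : nat) : pred (vgraph n s) :=
  fun G => cyclomatic (rep G) == k%:Z.

Definition Vloopless (k : nat) : pred (vgraph n s) :=
  fun G => [&& G \in Vgraphs k, is_connected (rep G) & is_loopless (rep G)].

Definition symmetry_factor (G : vgraph n s) : nat := #|automorphisms (rep G)|.

Definition viso : rel (vgraph n s) := fun G H => isomorphic (rep G) (rep H).

(* A finite set, since isomorphic graphs have equally many ends; see          *)
(* [mem_iso_class].                                                           *)
Definition iso_class (G : vgraph n s) : {fset vgraph n s} :=
  [fset vclass H
    | H in [set H : graph 'I_n 'I_(tag (repr G)) s | isomorphic (rep G) H]]%fset.

Lemma rep_vclass e (G : graph 'I_n 'I_e s) :
  end_isomorphic (rep (vclass G)) G.
Proof.
have /eqmodP : repr (vclass G) = pregraph_of G %[mod vgraph n s].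
  by rewrite reprK.
by [].
Qed.

Lemma mem_iso_class (G H : vgraph n s) : (H \in iso_class G) = viso G H.
Proof.
apply/imfsetP/idP => [[L /= + ->]|].
  rewrite inE => /isomorphicP[f [g i]].
  have /end_isomorphicP[h j] := rep_vclass L.
  have /and3P[_ /bijectiveP[h' hK hK'] _] := j.
  apply/isomorphicP; exists f, (h' \o g).
  exact: is_iso_comp i (is_iso_inv (fun=> erefl) (fun=> erefl) hK hK' j).
move=> GH; suff [L /eqP eHL] :
    exists L : graph 'I_n 'I_(tag (repr G)) s, vclass L == H.
  exists L => //=; rewrite inE; case/isomorphicP: GH => f [g i].
  have := rep_vclass L; rewrite eHL => /end_isomorphicP[h j].
  by apply/isomorphicP; exists f, (h \o g); apply: is_iso_comp i j.
have eE : tag (repr H) = tag (repr G).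
  case/isomorphicP: GH => f [g /and3P[_ /bijectiveP/bij_eq_card]].
  by rewrite !card_ord.
have HE : vclass (rep H) = H.
  by rewrite /vclass /pregraph_of /rep taggedK reprK.
by rewrite -eE; exists (rep H); rewrite HE.
Qed.
End VGraph.

(* The free Q-vector space on [vgraph n s]; <<G>> is the basis vector of G    *)
(* and x@_G is the coefficient of G in x.                                     *)
Notation QV n s := {malg rat[vgraph n s]}.

Definition linext n n' s (f : vgraph n s -> QV n' s) (x : QV n s) : QV n' s :=
  \sum_(G <- msupp x) x@_G *: f G.

Section Maps.
Variables n s : nat.

Definition l_map (i j : 'I_n) : QV n s -> QV n s :=
  linext (fun G => << vclass (add_edge i j (rep G)) >>).

Definition la_map (i j : 'I_n) : QV n s -> QV n s :=
  linext (fun G => if adjacent (rep G) i j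
                   then << vclass (add_edge i j (rep G)) >> else 0).

Definition s_map (i : 'I_n) : QV n s -> QV n.+1 s :=
  linext (fun G =>
    \sum_(E : {set 'I_(tag (repr G))} * {set 'I_(tag (repr G))}
           | (E.1 :|: E.2 == ends_at (rep G) i) && [disjoint E.1 & E.2])
       << vclass (split_graph E.2 (rep G)) >>).
End Maps.

Definition q_map n s (i : 'I_n) (x : QV n s) : QV n.+1 s :=
  (1 / 2) *: l_map (old_vertex i) ord_max (s_map i x).

(* There is no graph without vertices; the value at n = 0 is a dummy. *)
Fixpoint theta (s n : nat) : nat -> QV n s :=
  match n return nat -> QV n s with
  | 0 => fun _ => 0
  | p.+1 =>
    match p return (nat -> QV p s) -> nat -> QV p.+1 s with
    | 0 => fun _ k => if k is 0 then << vclass (point_graph s) >> else 0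
    | p'.+1 => fun theta_p =>
        fix theta_n (k : nat) : QV p'.+2 s :=
          (1 / (k + p'.+2 - 1)%N%:R) *:
            (\sum_(i < p'.+1) q_map i (theta_p k)
             + match k with
               | 0 => 0
               | k'.+1 => \sum_(i < p'.+2) \sum_(j < p'.+2 | (j < i)%N)
                            la_map i j (theta_n k')
               end)
    end (theta s p)
  end.

(* Main.v *)
Require Import Defs.
From mathcomp Require Import all_boot all_order all_algebra all_fingroup.
From mathcomp Require Import generic_quotient finmap monalg.
From mathcomp Require Import zify ring.

Set Implicit Arguments.
Unset Strict Implicit.
Unset Printing Implicit Defensive.

Import Order.TTheory GRing.Theory Num.Theory.
Local Open Scope ring_scope.

(** The numbers [(theta s n k)@_G] are not constant on isomorphism classes, so
    they are not computed one by one. Instead [theta s n k] is evaluated on the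
    linear functionals whose values [F] on graphs are constant on isomorphism
    classes, and the result ([theta_pairing]) is that for all such [F]

      < theta s n k, F > = 1 / (n! e!) * (the sum of F H over all H),

    where [H] runs through the loopless connected graphs with [m = k + n - 1]
    internal edges whose vertices are the elements of ['I_n] and whose ends are
    the elements of ['I_e]; such a graph has [e = 2 (m + s)] ends. No symmetry
    factor occurs in this formula, because vertices and ends of [H] are labeled.
    The symmetry factors come back at the end: for [F] the indicator function of
    the isomorphism class of [G], the right-hand side is the number of graphs
    [H] isomorphic to [G] divided by [n! e!], and this is [1 / S^G] by the
    orbit-stabilizer formula for the group of renamings of vertices and ends
    ([card_isomorphic]).

    The formula is proved by induction along the recursion, after multiplying it
    by [m]. A graph with [m] internal edges has [2 m] ordered pairs of ends that
    form an internal edge, and renaming ends moves any pair of ends to any other;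
    hence [2 m] times the sum over all [H] is [e (e - 1)] times the sum over those
    [H] in which the last two ends form an internal edge ([sum_with_edge]). Such
    an [H] is [add_edge u v G] for exactly one triple [u], [v], [G]. There are two
    cases ([sum_mark_edge]).
    - If [u] and [v] are adjacent in [G], then [G] is again loopless and connected.
      These graphs give the terms with the maps [la_map].
    - Otherwise contracting the new edge gives a loopless connected graph with one
      vertex less. By renaming vertices, [v] may be assumed to be the last vertex,
      and then contraction is undone by exactly one split ([sum_split]). These
      graphs give the terms with the maps [q_map], and the [n] possibilities for
      [v] turn [1 / n!] into [1 / (n - 1)!].
    Both ends of the new edge can come first, which accounts for the factor 1/2 in
    [q_map] and for the condition [j < i] in the sum of the maps [la_map].

    That a coefficient is positive exactly for the loopless connected graphs with
    [m] internal edges ([theta_supported]) follows from the same alternative for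
    one edge at the last vertex ([admissible_decomp]): deleting or contracting it
    gives a graph from which the recursion produces the given one with a positive
    coefficient. When [k = 0] only contraction can occur, because a connected graph
    with [n] vertices has at least [n - 1] edges ([admissible_tree_bound]). *)

(** * Ends, edges and adjacency *)

Section GraphBasics.
Variables (V K : finType) (s : nat) (G : graph V K s).
Implicit Types (a : {set K}) (x y : K) (u v : V).

Lemma edges_partition : partition (int_edges G :|: ext_edges G) [set: K].
Proof. by have /andP[_ /and5P[]] := gdata_wf G. Qed.

Lemma edges_disjoint : [disjoint int_edges G & ext_edges G].
Proof. by have /andP[_ /and5P[]] := gdata_wf G. Qed.

Lemma card_edge a : a \in int_edges G :|: ext_edges G -> #|a| = 2%N.
Proof.
by have /andP[_ /and5P[_ _ /forall_inP h _ _]] := gdata_wf G => /h/eqP.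
Qed.

Lemma vtx_int_edge a x : a \in int_edges G -> x \in a -> vtx G x != None.
Proof.
have /andP[_ /and5P[_ _ _ /forall_inP h _]] := gdata_wf G.
by move/h/forall_inP; apply.
Qed.

Lemma free_ext_edge a :
  a \in ext_edges G -> #|[set x in a | vtx G x == None]| = 1%N.
Proof.
have /andP[_ /and5P[_ _ _ _ /and3P[/forall_inP h _ _]]] := gdata_wf G.
by move/h/eqP.
Qed.

Lemma lab_inj : injective (lab G).
Proof. by have /andP[_ /and5P[_ _ _ _ /and3P[_ /injectiveP]]] := gdata_wf G. Qed.

Lemma vtx_free x : (vtx G x == None) = (x \in codom (lab G)).
Proof.
by have /andP[_ /and5P[_ _ _ _ /and3P[_ _ /forallP/(_ x)/eqP]]] := gdata_wf G.
Qed.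

Lemma vtx_lab j : vtx G (lab G j) = None.
Proof. by apply/eqP; rewrite vtx_free codom_f. Qed.

Lemma edge_uniq a b x : a \in int_edges G :|: ext_edges G ->
  b \in int_edges G :|: ext_edges G -> x \in a -> x \in b -> a = b.
Proof.
have /and3P[_ tG _] := edges_partition.
by move=> aG bG xa xb; rewrite -(def_pblock tG aG xa) (def_pblock tG bG xb).
Qed.

Lemma edge_at x :
  exists2 a, a \in int_edges G :|: ext_edges G & x \in a.
Proof.
have /and3P[/eqP cG _ _] := edges_partition.
by have /bigcupP[a aG xa] : x \in cover (int_edges G :|: ext_edges G);
  [rewrite cG inE | exists a].
Qed.

Lemma int_edgeP a : a \in int_edges G -> exists x y u v,
  [/\ x != y, a = [set x; y], vtx G x = Some u & vtx G y = Some v].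
Proof.
move=> aG; have /eqP/cards2P[x [y [ne_xy def_a]]] : #|a| = 2%N.
  by apply: card_edge; rewrite inE aG.
have vN z : z \in a -> exists w, vtx G z = Some w.
  by move/(vtx_int_edge aG); case: (vtx G z) => [w|//] _; exists w.
have [u xu] : exists u, vtx G x = Some u by apply: vN; rewrite def_a set21.
have [v yv] : exists v, vtx G y = Some v by apply: vN; rewrite def_a set22.
by exists x, y, u, v.
Qed.

Lemma int_edge_neq x y : [set x; y] \in int_edges G -> x != y.
Proof.
move=> aG; have : #|[set x; y]| = 2%N by apply: card_edge; rewrite inE aG.
by rewrite cards2; case: eqP.
Qed.

(** The definition only matches the two ends of an edge with [u] and [v] as
    unordered pairs of vertices; here the ends are named in the order of their
    vertices. *)
Lemma adjacentP u v :
  reflect (exists x y,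
    [/\ [set x; y] \in int_edges G, vtx G x = Some u & vtx G y = Some v])
  (adjacent G u v).
Proof.
apply: (iffP exists_inP) => [[a aG]|[x [y [aG xu yv]]]]; last first.
  by exists [set x; y] => //; rewrite /joins imsetU !imset_set1 xu yv.
have [x [y [w [z [_ def_a xw yz]]]]] := int_edgeP aG.
rewrite /joins def_a imsetU !imset_set1 xw yz => /eqP/setP e.
have es (b c : V) : (Some b == Some c) = (b == c) by [].
have [[wu zv]|[wv zu]] : w = u /\ z = v \/ w = v /\ z = u.
- have := e (Some w); have := e (Some z); have := e (Some v); have := e (Some u).
  rewrite !inE !eqxx !orbT /= !es => hu hv /esym hz /esym hw.
  case/orP: hw => /eqP ew; case/orP: hz => /eqP ez; subst w z.
  + by move: hv; rewrite orbb => /eqP ->; left.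
  + by left.
  + by right.
  + by move: hu; rewrite orbb => /eqP ->; left.
- by exists x, y; rewrite -def_a xw yz wu zv.
- by exists y, x; rewrite setUC -def_a xw yz wv zu.
Qed.

Lemma adjacent_sym : symmetric (adjacent G).
Proof.
have h u v : adjacent G u v -> adjacent G v u.
  by case/adjacentP=> x [y [aG xu yv]]; apply/adjacentP; exists y, x; rewrite setUC.
by move=> u v; apply/idP/idP; apply: h.
Qed.

Lemma looplessP : reflect (forall v, ~~ adjacent G v v) (is_loopless G).
Proof.
apply: (iffP forall_inP) => [h v|h a aG].
  by apply/exists_inP => -[a /h/forallP/(_ v)/negP].
by apply/forallP => v; apply: contra (h v) => av; apply/exists_inP; exists a.
Qed.

Lemma connectedP :
  reflect (forall u v, connect (adjacent G) u v) (is_connected G).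
Proof.
by apply: (iffP forallP) => [h u|h u]; [exact/forallP | apply/forallP => v].
Qed.

End GraphBasics.

(** For connected graphs on a fixed vertex set, the number of internal edges is as
    good an index as the cyclomatic number, and it changes by one with every step
    of the recursion. *)
Definition admissible (V K : finType) s (m : nat) (G : graph V K s) : bool :=
  [&& is_connected G, is_loopless G & #|int_edges G| == m].

Lemma connected_n_comp (V K : finType) s (G : graph V K s) :
  is_connected G -> (0 < #|V|)%N -> n_comp (adjacent G) predT = 1%N.
Proof.
move=> /connectedP cG /card_gt0P[v _].
have sG : connect_sym (adjacent G) by apply/sym_connect_sym/adjacent_sym.
rewrite -(n_comp_connect sG v); apply: eq_n_comp_r => u.
by rewrite !inE cG.
Qed.

Lemma Vloopless_admissible s n k (G : vgraph n.+1 s) :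
  (G \in Vloopless k) = admissible (k + n) (rep G).
Proof.
rewrite unfold_in /Vloopless /admissible unfold_in /Vgraphs /cyclomatic.
have [cG|] := boolP (is_connected _); last by rewrite andbF.
case: is_loopless; rewrite ?andbF //= !andbT.
rewrite connected_n_comp ?card_ord //; lia.
Qed.

Section EndsCount.
Variables (V K : finType) (s : nat) (G : graph V K s).

Lemma card_free : #|[set x | vtx G x == None]| = s.
Proof.
rewrite -[RHS]card_ord -(card_codom (@lab_inj _ _ _ G)).
by apply: eq_card => x; rewrite inE vtx_free.
Qed.

(** Both sides count free ends, the left one edge by edge. *)
Lemma card_ext_edges : #|ext_edges G| = s.
Proof.
apply: etrans card_free; rewrite -sum1_card -[RHS]sum1_card; symmetry.
rewrite (partition_big (fun x => pblock (int_edges G :|: ext_edges G) x)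
  (mem (ext_edges G))) /= => [|x].
  apply: eq_bigr => a aG; rewrite -[RHS](free_ext_edge aG) -sum1_card.
  apply: eq_bigl => x; rewrite !inE andbC; congr (_ && _).
  have aE : a \in int_edges G :|: ext_edges G by rewrite inE aG orbT.
  have /and3P[/eqP cG tG n0] := edges_partition G.
  apply/eqP/idP => [<-|xa]; last exact: def_pblock.
  by rewrite mem_pblock cG inE.
rewrite inE => /eqP xF.
have /and3P[/eqP cG tG n0] := edges_partition G.
have [a aE xa] := edge_at G x; rewrite (def_pblock tG aE xa).
move: aE; rewrite inE => /orP[aI|//].
by have := vtx_int_edge aI xa; rewrite xF.
Qed.

(** The number of ends is thus determined by the number of internal edges, so all
    graphs over which the final formula sums have the same set of ends. *)
Lemma card_ends : #|K| = (#|int_edges G| + s).*2.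
Proof.
have pG := edges_partition G.
rewrite -cardsT (card_uniform_partition (@card_edge _ _ _ G) pG).
have := edges_disjoint G; rewrite -setI_eq0 => /eqP dG.
by rewrite cardsU dG cards0 subn0 card_ext_edges muln2.
Qed.

End EndsCount.

(** * Isomorphisms, renaming and the orbit-stabilizer formula *)

Section IsoProps.
Variables (V K V' K' : finType) (s : nat).
Variables (f : V -> V') (g : K -> K') (G : graph V K s) (H : graph V' K' s).
Hypothesis iso : is_iso f g G H.

Lemma iso_bijV : bijective f.
Proof. by have /andP[/bijectiveP] := iso. Qed.

Lemma iso_bijK : bijective g.
Proof. by have /and3P[_ /bijectiveP] := iso. Qed.

Lemma iso_int (a : {set K}) : (g @: a \in int_edges H) = (a \in int_edges G).
Proof. by have /and3P[_ _ /and4P[/forallP/(_ a)/eqP]] := iso. Qed.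

Lemma iso_ext (a : {set K}) : (g @: a \in ext_edges H) = (a \in ext_edges G).
Proof. by have /and3P[_ _ /and4P[_ /forallP/(_ a)/eqP]] := iso. Qed.

Lemma iso_vtx x : vtx H (g x) = omap f (vtx G x).
Proof. by have /and3P[_ _ /and4P[_ _ /forallP/(_ x)/eqP]] := iso. Qed.

Lemma iso_lab j : lab H j = g (lab G j).
Proof. by have /and3P[_ _ /and4P[_ _ _ /forallP/(_ j)/eqP]] := iso. Qed.

Lemma iso_int_edges : int_edges H = [set g @: a | a : {set _} in int_edges G].
Proof.
have [g' gK g'K] := iso_bijK.
have gs (a : {set K'}) : a = g @: (g' @: a).
  by rewrite -imset_comp (eq_imset _ (g'K : g \o g' =1 id)) imset_id.
apply/setP => a; apply/idP/imsetP => [aH|[b bG ->]]; last by rewrite iso_int.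
by exists (g' @: a); rewrite -?gs // -iso_int -gs.
Qed.

Lemma iso_ext_edges : ext_edges H = [set g @: a | a : {set _} in ext_edges G].
Proof.
have [g' gK g'K] := iso_bijK.
have gs (a : {set K'}) : a = g @: (g' @: a).
  by rewrite -imset_comp (eq_imset _ (g'K : g \o g' =1 id)) imset_id.
apply/setP => a; apply/idP/imsetP => [aH|[b bG ->]]; last by rewrite iso_ext.
by exists (g' @: a); rewrite -?gs // -iso_ext -gs.
Qed.

Lemma iso_adjacent u v : adjacent H (f u) (f v) = adjacent G u v.
Proof.
have [f' fK _] := iso_bijV; have [g' gK g'K] := iso_bijK.
have oK (o : option V) w : omap f o = Some (f w) -> o = Some w.
  by case: o => //= z [/(can_inj fK) ->].
apply/adjacentP/adjacentP => -[x [y [aG xu yv]]].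
  exists (g' x), (g' y); split.
  - by rewrite -iso_int imsetU !imset_set1 !g'K.
  - by apply: oK; rewrite -iso_vtx g'K.
  - by apply: oK; rewrite -iso_vtx g'K.
exists (g x), (g y); rewrite !iso_vtx xu yv; split=> //.
by rewrite -iso_int imsetU !imset_set1 in aG *.
Qed.

Lemma iso_card_int : #|int_edges H| = #|int_edges G|.
Proof. by rewrite iso_int_edges card_imset //; apply/imset_inj/bij_inj/iso_bijK. Qed.

End IsoProps.

Lemma is_isoI (V K V' K' : finType) s (f : V -> V') (g : K -> K')
    (G : graph V K s) (H : graph V' K' s) :
  bijective f -> bijective g ->
  int_edges H = [set g @: a | a : {set _} in int_edges G] ->
  ext_edges H = [set g @: a | a : {set _} in ext_edges G] ->
  (forall x, vtx H (g x) = omap f (vtx G x)) ->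
  (forall j, lab H j = g (lab G j)) -> is_iso f g G H.
Proof.
move=> bf bg eI eE ev el.
have gi := imset_inj (bij_inj bg).
apply/and3P; split; [exact/bijectiveP | exact/bijectiveP | apply/and4P; split].
- by apply/forallP => a; rewrite eI (mem_imset _ _ gi).
- by apply/forallP => a; rewrite eE (mem_imset _ _ gi).
- by apply/forallP => x; rewrite ev.
- by apply/forallP => j; rewrite el.
Qed.

Lemma iso_admissible_imp (V K V' K' : finType) s f g (G : graph V K s)
    (H : graph V' K' s) m :
  is_iso f g G H -> admissible m G -> admissible m H.
Proof.
move=> i /and3P[/connectedP cG /looplessP lG mG]; apply/and3P; split.
- apply/connectedP => u v; have [f' fK f'K] := iso_bijV i.
  rewrite -[u]f'K -[v]f'K.
  have /connectP[p pp ->] := cG (f' u) (f' v).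
  elim: p (f' u) pp => [|y p IH] x /=; first by rewrite connect0.
  case/andP=> xy /IH; apply: connect_trans; apply: connect1.
  by rewrite (iso_adjacent i).
- apply/looplessP => v; have [f' fK f'K] := iso_bijV i.
  by rewrite -[v]f'K (iso_adjacent i).
- by rewrite (iso_card_int i).
Qed.

Lemma isomorphic_sym (V K V' K' : finType) s (G : graph V K s)
  (H : graph V' K' s) : isomorphic G H -> isomorphic H G.
Proof.
case/isomorphicP=> f [g i]; apply/isomorphicP.
have [f' fK f'K] := iso_bijV i; have [g' gK g'K] := iso_bijK i.
by exists f', g'; apply: is_iso_inv i.
Qed.

Lemma isomorphic_trans (V K V' K' V'' K'' : finType) s (G : graph V K s)
    (H : graph V' K' s) (L : graph V'' K'' s) :
  isomorphic G H -> isomorphic H L -> isomorphic G L.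
Proof.
case/isomorphicP=> f [g i] /isomorphicP[f' [g' i']]; apply/isomorphicP.
by exists (f' \o f), (g' \o g); apply: is_iso_comp i i'.
Qed.

Lemma end_isomorphicW (V K K' : finType) s (G : graph V K s)
  (H : graph V K' s) : end_isomorphic G H -> isomorphic G H.
Proof. by case/end_isomorphicP=> g i; apply/isomorphicP; exists id, g. Qed.

Lemma isomorphic_admissible (V K V' K' : finType) s (G : graph V K s)
    (H : graph V' K' s) m :
  isomorphic G H -> admissible m G = admissible m H.
Proof.
move=> GH; apply/idP/idP.
  by case/isomorphicP: GH => f [g]; apply: iso_admissible_imp.
by case/isomorphicP: (isomorphic_sym GH) => f [g]; apply: iso_admissible_imp.
Qed.

Lemma card_perm_type (T : finType) : #|{perm T}| = (#|T|)`!.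
Proof.
rewrite -[#|T|]cardsT -card_perm; apply: eq_card => t.
by rewrite inE; apply/esym/subsetP => x _; rewrite inE.
Qed.

Section Relabel.
Variables (V K : finType) (s : nat).
Implicit Types (G H : graph V K s) (p : {perm V}) (q : {perm K}).

Definition relabel_data p q G : graph_data V K s := {|
  int_edges := [set q @: a | a : {set _} in int_edges G];
  ext_edges := [set q @: a | a : {set _} in ext_edges G];
  vtx := [ffun x => omap p (vtx G ((q^-1)%g x))];
  lab := [ffun j => q (lab G j)] |}.

Lemma relabel_wf p q G : graph_wf (relabel_data p q G).
Proof.
have vq x : vtx (relabel_data p q G) (q x) = omap p (vtx G x).
  by rewrite ffunE permK.
have vN x : (vtx (relabel_data p q G) (q x) == None) = (vtx G x == None).
  by rewrite vq; case: (vtx G x).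
have mq x (a : {set K}) : (q x \in q @: a) = (x \in a).
  exact/mem_imset/perm_inj.
have := gdata_wf G; rewrite /graph_wf => /andP[V0].
case/and5P=> /and3P[/eqP cG tG n0] dG /forall_inP c2 /forall_inP fi.
case/and3P=> /forall_inP fe /injectiveP linj /forallP lc.
apply/andP; split=> //.
have eE : int_edges (relabel_data p q G) :|: ext_edges (relabel_data p q G) =
    [set q @: a | a : {set K} in int_edges G :|: ext_edges G].
  by rewrite imsetU.
rewrite eE; apply/and5P; split.
- apply: partition_setT.
  + apply/imsetP => -[a aG /esym/eqP]; rewrite imset_eq0 => /eqP a0.
    by rewrite -a0 aG in n0.
  + move=> x; rewrite -[x](permKV q).
    have [a aG xa] := edge_at G (q^-1 x)%g.
    by exists (q @: a); [apply: imset_f | rewrite mq].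
  + move=> _ _ x /imsetP[a aG ->] /imsetP[b bG ->].
    rewrite -[x](permKV q) !mq => xa xb.
    by rewrite (edge_uniq aG bG xa xb).
- rewrite disjoint_subset; apply/subsetP => _ /imsetP[a aG ->].
  rewrite inE; apply/imsetP => -[b bG /(imset_inj (@perm_inj _ q)) ab].
  by move/disjointFr: dG => /(_ _ aG); rewrite ab bG.
- apply/forall_inP => _ /imsetP[a aG ->].
  by rewrite card_imset ?c2 //; apply: perm_inj.
- apply/forall_inP => _ /imsetP[a aG ->]; apply/forall_inP => _ /imsetP[x xa ->].
  by rewrite vN (vtx_int_edge aG).
apply/and3P; split.
- apply/forall_inP => _ /imsetP[a aG ->]; apply/eqP.
  rewrite -[RHS](free_ext_edge aG) -[RHS](card_imset _ (@perm_inj _ q)).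
  by apply: eq_card => x; rewrite -[x](permKV q) inE !mq inE vN.
- by apply/injectiveP => i j; rewrite !ffunE => /perm_inj/linj.
- apply/forallP => x; rewrite -[x](permKV q) vN vtx_free.
  apply/eqP; apply/codomP/codomP => -[j]; first by move=> ->; exists j; rewrite ffunE.
  by rewrite ffunE => /perm_inj ->; exists j.
Qed.

Definition relabel p q G := Graph (relabel_wf p q G).

Lemma graph_ext G H : int_edges G = int_edges H -> ext_edges G = ext_edges H ->
  vtx G =1 vtx H -> lab G =1 lab H -> G = H.
Proof.
case: G H => [[a b c d] wG] [[a' b' c' d'] wH] /= ei ee /ffunP ev /ffunP el.
by apply: val_inj; rewrite /= ei ee ev el.
Qed.

Lemma relabel_iso p q G : is_iso p q G (relabel p q G).
Proof.
have qi : injective (fun a : {set K} => q @: a) by apply/imset_inj/perm_inj.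
apply/andP; split; last (apply/and5P; split).
- by apply/bijectiveP; exists (p^-1)%g => x; rewrite ?permK ?permKV.
- by apply/bijectiveP; exists (q^-1)%g => x; rewrite ?permK ?permKV.
- by apply/forallP => a; rewrite /= (mem_imset _ _ qi).
- by apply/forallP => a; rewrite /= (mem_imset _ _ qi).
- by apply/forallP => x; rewrite ffunE permK.
- by apply/forallP => j; rewrite ffunE.
Qed.

Lemma isomorphic_relabel p q G : isomorphic G (relabel p q G).
Proof. by apply/isomorphicP; exists p, q; apply: relabel_iso. Qed.

(** This makes the automorphisms of [G] the stabilizer of [G], and the graphs
    isomorphic to [G] its orbit, under the group of all renamings. *)
Lemma is_isoE p q G H : is_iso p q G H = (relabel p q G == H).
Proof.
apply/idP/eqP => [i|<-]; last exact: relabel_iso.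
apply: graph_ext => [||x|j].
- by rewrite (iso_int_edges i).
- by rewrite (iso_ext_edges i).
- by rewrite ffunE -[in RHS](permKV q x) (iso_vtx i).
- by rewrite (iso_lab i) ffunE.
Qed.

Definition relabel_act G (r : {perm V} * {perm K}) := relabel r.1 r.2 G.

Lemma relabel_is_action : is_action [set: {perm V} * {perm K}] relabel_act.
Proof.
apply: is_total_action => [G|G [p q] [p' q']]; apply/eqP; rewrite -is_isoE /=.
  by rewrite (@eq_is_iso _ _ _ _ _ G G _ id _ id) ?is_iso_id // => x; exact: perm1.
rewrite (@eq_is_iso _ _ _ _ _ _ _ _ (p' \o p) _ (q' \o q)).
- by apply: is_iso_comp; apply: relabel_iso.
- by move=> x; rewrite permM.
- by move=> x; rewrite permM.
Qed.
Canonical relabel_action := Action relabel_is_action.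

Lemma isomorphic_relabelP G H :
  reflect (exists r, H = relabel_act G r) (isomorphic G H).
Proof.
apply: (iffP idP) => [/isomorphicP[f [g i]]|[r ->]]; last exact: isomorphic_relabel.
have fi := bij_inj (iso_bijV i); have gi := bij_inj (iso_bijK i).
exists (perm fi, perm gi); apply/eqP; rewrite eq_sym -is_isoE.
by rewrite (@eq_is_iso _ _ _ _ _ _ _ _ f _ g) // => x; rewrite permE.
Qed.

(** The orbit-stabilizer formula. *)
Lemma card_isomorphic G :
  (#|[set H : graph V K s | isomorphic G H]| * #|automorphisms G|
     = (#|V|)`! * (#|K|)`!)%N.
Proof.
have -> : [set H : graph V K s | isomorphic G H] = orbit relabel_action setT G.
  apply/setP => H; rewrite inE; apply/isomorphic_relabelP/orbitP.
    by case=> r ->; exists r.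
  by case=> r _ <-; exists r.
have -> : automorphisms G = 'C_(setT)[G | relabel_action]%g.
  apply/setP => -[p q]; rewrite inE is_isoE /= setTI.
  by apply/eqP/astab1P.
by rewrite card_orbit_stab cardsT card_prod !card_perm_type.
Qed.

End Relabel.

(** * Linear functionals on graphs *)

Section VClass.
Variables n s : nat.

Lemma vclass_rep (G : vgraph n s) : vclass (rep G) = G.
Proof. by rewrite /vclass /pregraph_of /rep taggedK reprK. Qed.

Lemma end_isomorphic_vclass e e' (G : graph 'I_n 'I_e s)
  (H : graph 'I_n 'I_e' s) : end_isomorphic G H -> vclass G = vclass H.
Proof. by move=> GH; apply/eqmodP. Qed.

(** Constancy on isomorphism classes, stated for all representatives of the graphs
    because the representatives chosen by [rep] have no useful form. *)
Definition iso_invariant (F : vgraph n s -> rat) :=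
  forall e e' (G : graph 'I_n 'I_e s) (H : graph 'I_n 'I_e' s),
    isomorphic G H -> F (vclass G) = F (vclass H).

Lemma isomorphic_rep_vclass e (G : graph 'I_n 'I_e s) :
  isomorphic (rep (vclass G)) G.
Proof. exact/end_isomorphicW/rep_vclass. Qed.

End VClass.

(** The linear functional on vectors that extends [F]; single coefficients and
    weighted sums of coefficients are all values of such functionals. *)
Definition pairing n s (x : QV n s) (F : vgraph n s -> rat) : rat :=
  mmap idfun F x.

Section Pairing.
Variables n s : nat.
Implicit Types (x y : QV n s) (F : vgraph n s -> rat).

Lemma pairingE x F : pairing x F = \sum_(G <- msupp x) x@_G * F G.
Proof. by []. Qed.

Lemma pairing0 F : pairing 0 F = 0.
Proof. exact: mmap0. Qed.

Lemma pairingD x y F : pairing (x + y) F = pairing x F + pairing y F.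
Proof. exact: mmapD. Qed.

Lemma pairing_sum I (r : seq I) (P : pred I) (x_ : I -> QV n s) F :
  pairing (\sum_(i <- r | P i) x_ i) F = \sum_(i <- r | P i) pairing (x_ i) F.
Proof. exact: raddf_sum. Qed.

Lemma pairingZ c x F : pairing (c *: x) F = c * pairing x F.
Proof.
rewrite /pairing (mmapEw (msuppZ_le _ _)) mmapE big_distrr /=.
by apply: eq_bigr => G _; rewrite mcoeffZ mulrA.
Qed.

Lemma pairingZr c x F : pairing x (fun G => c * F G) = c * pairing x F.
Proof.
by rewrite !pairingE mulr_sumr; apply: eq_bigr => G _; rewrite mulrCA.
Qed.

Lemma pairing1 G F : pairing << G >> F = F G.
Proof. by rewrite /pairing mmapU mul1r. Qed.

Lemma eq_pairing x F F' : {in msupp x, F =1 F'} -> pairing x F = pairing x F'.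
Proof. by move=> eF; apply: eq_big_seq => G /eF ->. Qed.

Lemma pairing_sumr I (r : seq I) (P : pred I) x (F_ : I -> vgraph n s -> rat) :
  pairing x (fun G => \sum_(i <- r | P i) F_ i G)
    = \sum_(i <- r | P i) pairing x (F_ i).
Proof.
by rewrite pairingE exchange_big /=; apply: eq_bigr => G _; rewrite mulr_sumr.
Qed.

(** A coefficient is the value of a functional too, but not of an invariant one. *)
Lemma mcoeff_pairing x G : x@_G = pairing x (fun H => (H == G)%:R).
Proof.
rewrite pairingE; case: msuppP => [|Gx].
  move=> Gx; rewrite (bigD1_seq G) //= ?fset_uniq // eqxx mulr1 big1 ?addr0 //.
  by move=> H /negbTE ->; rewrite mulr0.
by rewrite big_seq big1 // => H Hx; case: eqP Hx Gx => [->->|] //; rewrite mulr0.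
Qed.

End Pairing.

Section PairingMaps.
Variables n s : nat.
Implicit Types (x : QV n s) (F : vgraph n s -> rat).

(** On the side of functionals the maps of the recursion become their transposes,
    which are sums over operations on a single graph. *)
Lemma pairing_linext n' (f : vgraph n s -> QV n' s) x (F' : vgraph n' s -> rat) :
  pairing (linext f x) F' = pairing x (fun G => pairing (f G) F').
Proof.
by rewrite /linext pairing_sum; apply: eq_bigr => G _; rewrite pairingZ.
Qed.

Lemma pairing_l_map i j x F : pairing (l_map i j x) F =
  pairing x (fun G => F (vclass (add_edge i j (rep G)))).
Proof.
by rewrite pairing_linext; apply: eq_pairing => G _; rewrite pairing1.
Qed.

Lemma pairing_la_map i j x F : pairing (la_map i j x) F =
  pairing x (fun G => if adjacent (rep G) i j
                      then F (vclass (add_edge i j (rep G))) else 0).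
Proof.
rewrite pairing_linext; apply: eq_pairing => G _.
by case: ifP; rewrite ?pairing1 ?pairing0.
Qed.

(** An ordered splitting of a set is given by its second part. *)
Lemma pairing_s_map i x (F : vgraph n.+1 s -> rat) : pairing (s_map i x) F =
  pairing x (fun G => \sum_(B : {set _} | B \subset ends_at (rep G) i)
                        F (vclass (split_graph B (rep G)))).
Proof.
rewrite pairing_linext; apply: eq_pairing => G _.
rewrite pairing_sum.
under eq_bigr do rewrite pairing1.
rewrite (reindex_onto (fun B : {set _} => (ends_at (rep G) i :\: B, B))
                      snd) => [|[A B] /= /andP[/eqP <- AB]]; last first.
  by congr pair; rewrite setDUl setDv setU0; apply/setDidPl.
apply: eq_bigl => B; rewrite /= eqxx andbT.
rewrite -setI_eq0 setDE -setIA [~: B :&: B]setIC setICr setI0 eqxx andbT.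
by rewrite setUIl [~: B :|: B]setUC setUCr setIT (sameP eqP setUidPl).
Qed.

End PairingMaps.

(** * Adding and deleting an edge *)

Definition new_edge e : {set 'I_(e + 2)} :=
  [set new_end e ord0; new_end e ord_max].

Section NewEnds.
Variable e : nat.
Implicit Types (a : {set 'I_e}).

Lemma old_end_inj : injective (@old_end e). Proof. exact: lshift_inj. Qed.

Lemma old_ends_inj : injective (fun a => @old_end e @: a).
Proof. exact/imset_inj/old_end_inj. Qed.

Lemma mem_old_ends a x : (old_end x \in @old_end e @: a) = (x \in a).
Proof. exact/mem_imset/old_end_inj. Qed.

Lemma new_notin_old a b : (new_end e b \in @old_end e @: a) = false.
Proof. by apply/negP => /imsetP[x _ /eqP]; rewrite eq_rlshift. Qed.

Lemma new_edgeE : new_edge e = new_end e @: [set: 'I_2].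
Proof.
apply/setP => x; rewrite !inE; apply/orP/imsetP => [[]/eqP->|[b _ ->]].
- by exists ord0.
- by exists ord_max.
by rewrite !eq_rshift; case: b => [[|[|]]] //; [left | right].
Qed.

Lemma mem_new_edge b : new_end e b \in new_edge e.
Proof. by rewrite new_edgeE imset_f. Qed.

Lemma old_notin_new x : (old_end x \in new_edge e) = false.
Proof. by rewrite !inE !eq_lrshift. Qed.

Lemma old_ends_neq_new a : (@old_end e @: a == new_edge e) = false.
Proof.
by apply/negP => /eqP/setP/(_ (new_end e ord0)); rewrite new_notin_old mem_new_edge.
Qed.

End NewEnds.

Section AddEdgeProps.
Variables (V : finType) (e s : nat).
Implicit Types (i j u v : V) (G : graph V 'I_e s).

Lemma vtx_add_old i j G x : vtx (add_edge i j G) (old_end x) = vtx G x.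
Proof. by rewrite ffunE -[old_end x]/(unsplit (inl x)) unsplitK. Qed.

Lemma vtx_add_new i j G b :
  vtx (add_edge i j G) (new_end e b) = Some (if b == ord0 then i else j).
Proof. by rewrite ffunE -[new_end e b]/(unsplit (inr b)) unsplitK. Qed.

Lemma int_add_edge i j G : int_edges (add_edge i j G) =
  new_edge e |: [set @old_end e @: a | a : {set _} in int_edges G].
Proof. by []. Qed.

Lemma int_add_old i j G (a : {set 'I_e}) :
  (@old_end e @: a \in int_edges (add_edge i j G)) = (a \in int_edges G).
Proof.
by rewrite int_add_edge in_setU1 old_ends_neq_new (mem_imset _ _ (@old_ends_inj e)).
Qed.

Lemma ext_add_old i j G (a : {set 'I_e}) :
  (@old_end e @: a \in ext_edges (add_edge i j G)) = (a \in ext_edges G).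
Proof. by rewrite (mem_imset _ _ (@old_ends_inj e)). Qed.

Lemma new_edge_add i j G : new_edge e \in int_edges (add_edge i j G).
Proof. exact: setU11. Qed.

Lemma card_int_add_edge i j G :
  #|int_edges (add_edge i j G)| = #|int_edges G|.+1.
Proof.
rewrite int_add_edge cardsU1 (card_imset _ (@old_ends_inj e)).
by case: imsetP => // -[a _ /esym/eqP]; rewrite old_ends_neq_new.
Qed.

Lemma adjacent_add_edge i j G u v : adjacent (add_edge i j G) u v =
  [|| adjacent G u v, (u == i) && (v == j) | (u == j) && (v == i)].
Proof.
apply/adjacentP/or3P => [[x [y [xy]]]|].
  move: (xy); rewrite int_add_edge in_setU1 => /orP[/eqP xyN|/imsetP[a aG xya]].
    have: x \in new_edge e by rewrite -xyN set21.
    have: y \in new_edge e by rewrite -xyN set22.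
    have := int_edge_neq xy.
    rewrite new_edgeE => + /imsetP[b _ yb] /imsetP[c _ xc]; rewrite xc yb.
    rewrite !vtx_add_new.
    case: b c {xc yb} => [[|[|]]] // ? [[|[|]]] // ?; rewrite /= eq_rshift //.
      by move=> _ [<-] [<-]; constructor 3; rewrite !eqxx.
    by move=> _ [<-] [<-]; constructor 2; rewrite !eqxx.
  have: x \in @old_end e @: a by rewrite -xya set21.
  have: y \in @old_end e @: a by rewrite -xya set22.
  case/imsetP=> y' _ ey /imsetP[x' _ ex]; rewrite ex ey !vtx_add_old => xu yv.
  constructor 1; apply/adjacentP; exists x', y'; split=> //.
  by rewrite -(int_add_old i j) imsetU !imset_set1 -ex -ey.
case=> [/adjacentP[x [y [xy xu yv]]]|/andP[/eqP-> /eqP->]|/andP[/eqP-> /eqP->]].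
- exists (old_end x), (old_end y); rewrite !vtx_add_old; split=> //.
  by rewrite -[X in X \in _](_ : @old_end e @: [set x; y] = _) ?int_add_old //
             imsetU !imset_set1.
- exists (new_end e ord0), (new_end e ord_max); rewrite !vtx_add_new.
  by rewrite new_edge_add.
- exists (new_end e ord_max), (new_end e ord0); rewrite !vtx_add_new setUC.
  by rewrite new_edge_add.
Qed.

(** Together with [add_edge_onto] this makes [add_edge] a bijection onto the graphs
    in which the two new ends form an internal edge. *)
Lemma add_edge_inj i j G i' j' G' :
  add_edge i j G = add_edge i' j' G' -> [/\ i = i', j = j' & G = G'].
Proof.
move=> eG; split.
- by have := vtx_add_new i j G ord0; rewrite eG vtx_add_new => -[].
- by have := vtx_add_new i j G ord_max; rewrite eG vtx_add_new => -[].
apply: graph_ext => [||x|l].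
- by apply/setP => a; rewrite -(int_add_old i j) eG int_add_old.
- by apply/setP => a; rewrite -(ext_add_old i j) eG ext_add_old.
- by rewrite -(vtx_add_old i j) eG vtx_add_old.
- have /ffunP/(_ l) : lab (add_edge i j G) = lab (add_edge i' j' G') by rewrite eG.
  by rewrite !ffunE => /old_end_inj.
Qed.

(** The graph [G] is [H] with the edge deleted. The other edges avoid the two new
    ends, since distinct edges are disjoint, and so do the labels, since the ends
    of an internal edge are not free. *)
Lemma add_edge_onto (H : graph V 'I_(e + 2) s) :
  new_edge e \in int_edges H -> exists i j G, H = add_edge i j G.
Proof.
move=> NH; pose old (a : {set 'I_e}) := @old_end e @: a.
have NE : new_edge e \in int_edges H :|: ext_edges H by rewrite inE NH.
have vN b : vtx H (new_end e b) != None by rewrite (vtx_int_edge NH) ?mem_new_edge.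
have oldE a : a \in int_edges H :|: ext_edges H -> a != new_edge e ->
    a = old (@old_end e @^-1: a).
  move=> aE aN; apply/setP => x; case: (split_ordP x) => y ->.
    by rewrite mem_old_ends inE.
  rewrite (new_notin_old _ y); apply/negP => ya; case/eqP: aN.
  exact: edge_uniq aE NE ya (mem_new_edge e y).
have extN a : a \in ext_edges H -> a != new_edge e.
  by apply: contraTneq => ->; rewrite (disjointFr (edges_disjoint H) NH).
have lab_old m : exists y, lab H m = old_end y.
  have := vtx_lab H m; case: (split_ordP (lab H m)) => y ->; first by exists y.
  by have := vN y; rewrite /new_end; case: (vtx H _).
have [l lE] := fin_all_exists lab_old.
pose D : graph_data V 'I_e s := {|
  int_edges := [set a | old a \in int_edges H];
  ext_edges := [set a | old a \in ext_edges H];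
  vtx := [ffun x => vtx H (old_end x)];
  lab := [ffun m => l m] |}.
have wD : graph_wf D.
  have DE a : (a \in int_edges D :|: ext_edges D)
      = (old a \in int_edges H :|: ext_edges H) by rewrite !inE.
  apply/andP; split; first by have /andP[] := gdata_wf H.
  apply/and5P; split.
  - apply: partition_setT.
    + rewrite DE; apply/negP => /card_edge.
      by rewrite /old imset0 cards0.
    + move=> x; have [a aE xa] := edge_at H (old_end x).
      have aN : a != new_edge e by apply: contraTneq xa => ->; rewrite old_notin_new.
      exists (@old_end e @^-1: a); last by rewrite inE.
      by rewrite DE -oldE.
    + move=> a b x; rewrite !DE => aE bE xa xb; apply: (@old_ends_inj e).
      by apply: (edge_uniq aE bE (x := old_end x)); rewrite mem_old_ends.
  - rewrite disjoint_subset; apply/subsetP => a; rewrite !inE => aI.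
    by rewrite (disjointFr (edges_disjoint H) aI).
  - apply/forall_inP => a; rewrite DE => /card_edge.
    by rewrite card_imset => [->|]; last exact: old_end_inj.
  - apply/forall_inP => a; rewrite inE => aI; apply/forall_inP => x xa.
    by rewrite ffunE (vtx_int_edge aI) // mem_old_ends.
  apply/and3P; split.
  - apply/forall_inP => a; rewrite inE => /free_ext_edge <-.
    rewrite -(card_imset _ (@old_end_inj e)); apply/eqP/eq_card => x.
    rewrite inE; case: (split_ordP x) => y ->.
      by rewrite !mem_old_ends inE ffunE.
    by rewrite !(new_notin_old _ y).
  - apply/injectiveP => m m'; rewrite !ffunE => emm.
    by apply: (@lab_inj _ _ _ H); rewrite !lE emm.
  - apply/forallP => x; rewrite ffunE vtx_free; apply/eqP.
    apply/codomP/codomP => -[m].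
      by rewrite lE => /old_end_inj ->; exists m; rewrite ffunE.
    by rewrite ffunE => ->; exists m; rewrite lE.
have [i vi] : exists i, vtx H (new_end e ord0) = Some i.
  by have := vN ord0; case: (vtx H _) => // i _; exists i.
have [j vj] : exists j, vtx H (new_end e ord_max) = Some j.
  by have := vN ord_max; case: (vtx H _) => // j _; exists j.
exists i, j, (Graph wD); apply: graph_ext => [||x|m].
- apply/setP => a; rewrite int_add_edge in_setU1.
  have [->|aN] := eqVneq; first exact: NH.
  apply/idP/imsetP => [aI|[b]]; last by rewrite inE => bI ->.
  have ea : a = old (@old_end e @^-1: a) by apply: oldE; rewrite // inE aI.
  by exists (@old_end e @^-1: a); rewrite // inE -ea.
- apply/setP => a; apply/idP/imsetP => [aI|[b]]; last by rewrite inE => bI ->.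
  have ea : a = old (@old_end e @^-1: a).
    by apply: oldE; rewrite ?extN // inE aI orbT.
  by exists (@old_end e @^-1: a); rewrite // inE -ea.
- case: (split_ordP x) => y ->; first by rewrite vtx_add_old ffunE.
  rewrite (vtx_add_new _ _ _ y); case: y => [[|[|]]] //= p.
    by rewrite -vi; congr (vtx H (new_end e _)); apply: val_inj.
  by rewrite -vj; congr (vtx H (new_end e _)); apply: val_inj.
- by rewrite !ffunE lE.
Qed.

End AddEdgeProps.

(** * Splitting a vertex and contracting an edge *)

Definition end_map e e' (g : 'I_e -> 'I_e') (h : 'I_2 -> 'I_2) (x : 'I_(e + 2)) :
    'I_(e' + 2) :=
  match split x with inl y => old_end (g y) | inr b => new_end e' (h b) end.

Section EndMap.
Variables (e e' : nat) (g : 'I_e -> 'I_e') (h : 'I_2 -> 'I_2).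

Lemma end_map_old x : end_map g h (old_end x) = old_end (g x).
Proof. by rewrite /end_map -[old_end x]/(unsplit (inl x)) unsplitK. Qed.

Lemma end_map_new b : end_map g h (new_end e b) = new_end e' (h b).
Proof. by rewrite /end_map -[new_end e b]/(unsplit (inr b)) unsplitK. Qed.

End EndMap.

Lemma end_map_bij e e' (g : 'I_e -> 'I_e') (h : 'I_2 -> 'I_2) :
  bijective g -> bijective h -> bijective (end_map g h).
Proof.
case=> g' gK g'K [h' hK h'K]; exists (end_map g' h') => x;
  case: (split_ordP x) => y ->;
  by rewrite ?end_map_old ?end_map_new ?gK ?g'K // -/(new_end _ _)
             ?end_map_new ?hK ?h'K.
Qed.

(** The permutation [h] of the two new ends lets the new edge be turned around. *)
Lemma add_edge_iso (V V' : finType) e e' s (f : V -> V') (g : 'I_e -> 'I_e')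
    (h : 'I_2 -> 'I_2) (G : graph V 'I_e s) (H : graph V' 'I_e' s) i j i' j' :
  is_iso f g G H -> bijective h ->
  (forall b, (if h b == ord0 then i' else j') = f (if b == ord0 then i else j)) ->
  is_iso f (end_map g h) (add_edge i j G) (add_edge i' j' H).
Proof.
move=> iso bh hv; have bg := iso_bijK iso.
have oldI (A : {set {set 'I_e}}) :
    [set end_map g h @: a | a : {set _} in [set @old_end e @: b | b : {set _} in A]]
    = [set @old_end e' @: a | a : {set _} in [set g @: b | b : {set _} in A]].
  rewrite -!imset_comp; apply: eq_imset => a /=.
  by rewrite -!imset_comp; apply: eq_imset => x /=; rewrite end_map_old.
have newI : end_map g h @: new_edge e = new_edge e'.
  rewrite !new_edgeE; apply/setP => x.
  apply/imsetP/imsetP => -[y]; last first.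
    move=> _ ->.
    have [h' _ h'K] := bh; exists (new_end e (h' y)); first exact: imset_f.
    by rewrite end_map_new h'K.
  by case/imsetP=> b _ -> ->; exists (h b); rewrite ?end_map_new.
apply: is_isoI => //; [exact: iso_bijV iso|exact: end_map_bij|..].
- by rewrite !int_add_edge imsetU1 oldI (iso_int_edges iso) newI.
- by rewrite /= oldI (iso_ext_edges iso).
- move=> x; case: (split_ordP x) => y ->.
    by rewrite end_map_old !vtx_add_old (iso_vtx iso).
  by rewrite -/(new_end _ _) end_map_new !vtx_add_new /= hv.
- by move=> l; rewrite !ffunE end_map_old (iso_lab iso).
Qed.

Lemma isomorphic_add_edge (V V' : finType) e e' s (f : V -> V')
    (g : 'I_e -> 'I_e') (G : graph V 'I_e s) (H : graph V' 'I_e' s) i j :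
  is_iso f g G H -> isomorphic (add_edge i j G) (add_edge (f i) (f j) H).
Proof.
move=> iso; apply/isomorphicP; exists f, (end_map g id).
by apply: add_edge_iso => // [|b]; [exists id | case: ifP].
Qed.

Lemma vclass_add_edge n s e e' (G : graph 'I_n 'I_e s)
    (H : graph 'I_n 'I_e' s) i j :
  end_isomorphic G H -> vclass (add_edge i j G) = vclass (add_edge i j H).
Proof.
case/end_isomorphicP=> g iso; apply: end_isomorphic_vclass.
apply/end_isomorphicP; exists (end_map g id).
by apply: add_edge_iso => //; exists id.
Qed.

Lemma vclass_add_edgeC n s e (G : graph 'I_n 'I_e s) i j :
  vclass (add_edge i j G) = vclass (add_edge j i G).
Proof.
apply: end_isomorphic_vclass; apply/end_isomorphicP.
exists (end_map id (@rev_ord 2)).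
apply: add_edge_iso; first exact: is_iso_id.
  by exists (@rev_ord 2); apply: rev_ordK.
by case=> [[|[|]]].
Qed.

Definition extend_vertex n n' (f : 'I_n -> 'I_n') (v : 'I_n.+1) : 'I_n'.+1 :=
  if unlift ord_max v is Some w then old_vertex (f w) else ord_max.

Definition collapse n (i : 'I_n) (v : 'I_n.+1) : 'I_n :=
  if unlift ord_max v is Some w then w else i.

Section Vertices.
Variable n : nat.
Implicit Types (i : 'I_n).

Lemma old_vertexE i : old_vertex i = lift ord_max i.
Proof. by apply: ord_inj; rewrite lift_max. Qed.

Lemma old_neq_max i : (old_vertex i == ord_max) = false.
Proof. by rewrite old_vertexE eq_sym; apply/negbTE/neq_lift. Qed.

Variant vertex_spec : 'I_n.+1 -> Type :=
  | VertexOld i : vertex_spec (old_vertex i)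
  | VertexMax : vertex_spec ord_max.

Lemma vertexP v : vertex_spec v.
Proof.
case: (unliftP ord_max v) => [w|] ->; last by constructor.
by rewrite -old_vertexE; constructor.
Qed.

Lemma collapse_old i w : collapse i (old_vertex w) = w.
Proof. by rewrite /collapse old_vertexE liftK. Qed.

Lemma collapse_max i : collapse i ord_max = i.
Proof. by rewrite /collapse unlift_none. Qed.

End Vertices.

Lemma extend_old n n' (f : 'I_n -> 'I_n') w :
  extend_vertex f (old_vertex w) = old_vertex (f w).
Proof. by rewrite /extend_vertex old_vertexE liftK. Qed.

Lemma extend_max n n' (f : 'I_n -> 'I_n') : extend_vertex f ord_max = ord_max.
Proof. by rewrite /extend_vertex unlift_none. Qed.

Lemma extend_bij n n' (f : 'I_n -> 'I_n') :
  bijective f -> bijective (extend_vertex f).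
Proof.
by case=> f' fK f'K; exists (extend_vertex f') => v; case: (vertexP v) => [w|];
  rewrite ?extend_old ?extend_max ?fK ?f'K.
Qed.

Lemma vtx_split n (K : finType) s (B : {set K}) (G : graph 'I_n K s) x :
  vtx (split_graph B G) x =
  omap (fun v => if x \in B then ord_max else old_vertex v) (vtx G x).
Proof. by rewrite ffunE. Qed.

Lemma split_iso n n' (K K' : finType) s (f : 'I_n -> 'I_n') (g : K -> K')
    (G : graph 'I_n K s) (H : graph 'I_n' K' s) (B : {set K}) :
  is_iso f g G H ->
  is_iso (extend_vertex f) g (split_graph B G) (split_graph (g @: B) H).
Proof.
move=> iso; apply: is_isoI.
- exact/extend_bij/(iso_bijV iso).
- exact: iso_bijK iso.
- exact: iso_int_edges iso.
- exact: iso_ext_edges iso.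
- move=> x; rewrite !vtx_split (iso_vtx iso); case: (vtx G x) => //= v.
  rewrite mem_imset ?[in RHS]fun_if; last exact: bij_inj (iso_bijK iso).
  by case: (x \in B); rewrite ?extend_old ?extend_max.
- exact: iso_lab iso.
Qed.

Section Merge.
Variables (n : nat) (K : finType) (s : nat) (i : 'I_n).
Implicit Types (G : graph 'I_n K s) (H : graph 'I_n.+1 K s) (B : {set K}).

Definition contract_data H : graph_data 'I_n K s := {|
  int_edges := int_edges H;
  ext_edges := ext_edges H;
  vtx := [ffun x => omap (collapse i) (vtx H x)];
  lab := lab H |}.

Lemma contract_wf H : graph_wf (contract_data H).
Proof.
have vN x : (vtx (contract_data H) x == None) = (vtx H x == None).
  by rewrite ffunE; case: (vtx H x).
have := gdata_wf H; rewrite /graph_wf => /andP[_].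
case/and5P=> pG dG c2 /forall_inP fi /and3P[/forall_inP fe linj /forallP lc].
rewrite card_ord /= pG dG c2 linj (leq_ltn_trans (leq0n i)) //=.
apply/and3P; split.
- apply/forall_inP => e eG; apply/forall_inP => x xe; rewrite vN.
  exact: vtx_int_edge eG xe.
- apply/forall_inP => e eG; rewrite -(eqP (fe _ eG)); apply/eqP.
  by apply: eq_card => x; rewrite !inE vN.
- by apply/forallP => x; rewrite vN.
Qed.

(** The inverse of a split at [i]: the last vertex is contracted into [i], and the
    part of the split can be read off from the ends at the last vertex. *)
Definition contract H := Graph (contract_wf H).

Lemma vtx_contract H x : vtx (contract H) x = omap (collapse i) (vtx H x).
Proof. by rewrite ffunE. Qed.

Lemma split_contract H : split_graph (ends_at H ord_max) (contract H) = H.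
Proof.
apply: graph_ext => // x; rewrite vtx_split vtx_contract inE.
case: (vtx H x) => //= v; case: (vertexP v) => [w|]; last by rewrite eqxx.
by rewrite collapse_old (inj_eq Some_inj) old_neq_max.
Qed.

Lemma ends_at_split G B : B \subset ends_at G i ->
  ends_at (split_graph B G) ord_max = B.
Proof.
move=> /subsetP Bi; apply/setP => x; rewrite inE vtx_split.
case: (boolP (x \in B)) => [/Bi|xB]; first by rewrite inE => /eqP -> /=; rewrite eqxx.
by case: (vtx G x) => //= v; rewrite (inj_eq Some_inj) old_neq_max.
Qed.

Lemma contract_split G B : B \subset ends_at G i -> contract (split_graph B G) = G.
Proof.
move=> /subsetP Bi; apply: graph_ext => // x; rewrite vtx_contract vtx_split.
case: (boolP (x \in B)) => [/Bi|xB].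
  by rewrite inE => /eqP -> /=; rewrite collapse_max.
by case: (vtx G x) => //= v; rewrite collapse_old.
Qed.

Lemma contract_split_eq G B :
  (contract (split_graph B G) == G) && (ends_at (split_graph B G) ord_max == B)
    = (B \subset ends_at G i).
Proof.
apply/andP/idP => [[/eqP eG /eqP eB]|Bi]; last by rewrite contract_split ?ends_at_split.
apply/subsetP => x xB; rewrite inE -eG vtx_contract.
by move: xB; rewrite -{1}eB inE => /eqP -> /=; rewrite collapse_max.
Qed.

(** Every graph on one more vertex arises from exactly one split at [i]. *)
Lemma sum_split (P : pred (graph 'I_n.+1 K s)) (Phi : graph 'I_n.+1 K s -> rat) :
  \sum_(H | P H) Phi H =
  \sum_(G : graph 'I_n K s)
     \sum_(B : {set K} | (B \subset ends_at G i) && P (split_graph B G))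
       Phi (split_graph B G).
Proof.
rewrite pair_big_dep /= (reindex_onto
  (fun p : graph 'I_n K s * {set K} => split_graph p.2 p.1)
  (fun H => (contract H, ends_at H ord_max))) /=; last first.
  by move=> H _; apply: split_contract.
by apply: eq_bigl => -[G B] /=; rewrite xpair_eqE contract_split_eq andbC.
Qed.

Lemma adjacent_contract H u v : reflect (exists a b,
    [/\ collapse i a = u, collapse i b = v & adjacent H a b])
  (adjacent (contract H) u v).
Proof.
have oK (o : option 'I_n.+1) w : omap (collapse i) o = Some w ->
    exists2 a, o = Some a & collapse i a = w.
  by case: o => //= a [<-]; exists a.
apply: (iffP idP) => [|[a [b [<- <- /adjacentP[x [y [xy xa yb]]]]]]].
  case/adjacentP=> x [y [xy]]; rewrite !vtx_contract => /oK[a xa <-] /oK[b yb <-].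
  by exists a, b; split=> //; apply/adjacentP; exists x, y.
by apply/adjacentP; exists x, y; rewrite !vtx_contract xa yb.
Qed.

End Merge.

Lemma loopless_add_edge (V : finType) e s (u v : V) (G : graph V 'I_e s) :
  is_loopless (add_edge u v G) = is_loopless G && (u != v).
Proof.
apply/looplessP/andP => [h|[/looplessP lG uv] w].
  split; last first.
    have := h u; rewrite adjacent_add_edge eqxx /= orbA -orbA !negb_or.
    by case/and3P.
  by apply/looplessP => w; have := h w; rewrite adjacent_add_edge negb_or => /andP[].
rewrite adjacent_add_edge negb_or lG /= [(w == v) && _]andbC orbb.
by apply: contra uv => /andP[/eqP <- /eqP <-].
Qed.

Lemma loopless_contract n (K : finType) s (i : 'I_n) (H : graph 'I_n.+1 K s) :
  is_loopless (contract i H)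
    = is_loopless H && ~~ adjacent H (old_vertex i) ord_max.
Proof.
apply/looplessP/andP => [h|[/looplessP lH iH] u].
  split.
    apply/looplessP => a; apply: contra (h (collapse i a)) => aa.
    by apply/adjacent_contract; exists a, a.
  apply: contra (h i) => aa; apply/adjacent_contract.
  by exists (old_vertex i), ord_max; rewrite collapse_old collapse_max.
apply/adjacent_contract => -[a [b [<-]]].
case: (vertexP a) (vertexP b) => [w|] [z|]; rewrite ?collapse_old ?collapse_max.
- by move=> ->; apply/negP.
- by move=> <-; apply/negP.
- by move=> ->; rewrite adjacent_sym; apply/negP.
- by move=> _; apply/negP.
Qed.

(** A path of the contracted graph lifts, because the two vertices over [i] are
    joined by the new edge. *)
Lemma connected_contract n e s (i : 'I_n) (H : graph 'I_n.+1 'I_e s) :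
  is_connected (add_edge (old_vertex i) ord_max H) = is_connected (contract i H).
Proof.
set A := add_edge _ _ _; have sA : connect_sym (adjacent A).
  exact/sym_connect_sym/adjacent_sym.
have fib a : connect (adjacent A) a (old_vertex (collapse i a)).
  case: (vertexP a) => [w|]; first by rewrite collapse_old connect0.
  rewrite collapse_max; apply: connect1.
  by rewrite adjacent_add_edge !eqxx !orbT.
apply/connectedP/connectedP => [cA u v|cM a b].
  rewrite -(collapse_old i u) -(collapse_old i v).
  have /connectP[p] := cA (old_vertex u) (old_vertex v).
  elim: p (old_vertex u) => [|b p IH] a /=; first by move=> _ ->; apply: connect0.
  case/andP=> ab /IH h /h; apply: connect_trans.
  move: ab; rewrite adjacent_add_edge.
  case/or3P=> [ab|/andP[/eqP-> /eqP->]|/andP[/eqP-> /eqP->]].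
  - by apply/connect1/adjacent_contract; exists a, b.
  - by rewrite collapse_old collapse_max connect0.
  - by rewrite collapse_old collapse_max connect0.
have lift_path u v : connect (adjacent (contract i H)) u v ->
    connect (adjacent A) (old_vertex u) (old_vertex v).
  case/connectP=> p; elim: p u => [|w p IH] u /=; first by move=> _ ->; apply: connect0.
  case/andP=> /adjacent_contract[c [d [<- <- cd]]] /IH h /h.
  apply: connect_trans; apply: connect_trans (fib d).
  rewrite sA; apply: connect_trans (fib c); rewrite sA.
  by apply: connect1; rewrite adjacent_add_edge cd.
apply: connect_trans (fib a) _; rewrite sA; apply: connect_trans (fib b) _.
exact: lift_path.
Qed.

(** A loop of the contracted graph comes from a loop or from an edge between the
    two vertices that are identified; so the new edge has to be the only one. *)
Lemma admissible_contract n e s m (i : 'I_n) (H : graph 'I_n.+1 'I_e s) :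
  admissible m (contract i H)
    = admissible m.+1 (add_edge (old_vertex i) ord_max H)
      && ~~ adjacent H (old_vertex i) ord_max.
Proof.
rewrite /admissible connected_contract loopless_contract loopless_add_edge.
rewrite card_int_add_edge eqSS old_neq_max andbT /=.
by rewrite -!andbA; do 2!congr (_ && _); rewrite andbC.
Qed.

(** Deleting one of several parallel edges leaves the adjacency relation as it
    is. *)
Lemma admissible_add_parallel (V : finType) e s m (u v : V) (G : graph V 'I_e s) :
  adjacent G u v -> admissible m.+1 (add_edge u v G) = admissible m G.
Proof.
move=> uv; rewrite /admissible loopless_add_edge card_int_add_edge eqSS.
have -> : is_connected (add_edge u v G) = is_connected G.
  have eA : adjacent (add_edge u v G) =2 adjacent G.
    move=> x y; rewrite adjacent_add_edge; apply/or3P/idP; last by constructor 1.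
    by case=> // /andP[/eqP-> /eqP->] //; rewrite adjacent_sym.
  by apply/connectedP/connectedP => h x y; have := h x y; rewrite (eq_connect eA).
case: looplessP => //= lG; case: eqVneq uv => [->|//] vv.
by have := lG v; rewrite vv.
Qed.

(** * Counting graphs with a marked edge *)

Lemma perm_map2 (T : finType) (a b x y : T) :
  a != b -> x != y -> exists q : {perm T}, q a = x /\ q b = y.
Proof.
move=> ab xy; exists (tperm a x * tperm (tperm a x b) y)%g; rewrite !permM tpermL.
split; last by rewrite tpermL.
rewrite tpermD // 1?eq_sym // -[X in X != _](tpermL a x).
by rewrite (inj_eq perm_inj).
Qed.

Section Darts.
Variables (V K : finType) (s : nat).

Lemma card_darts (G : graph V K s) :
  #|[set p : K * K | [set p.1; p.2] \in int_edges G]| = (#|int_edges G|).*2.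
Proof.
rewrite -sum1_card -mul2n mulnC -sum_nat_const.
rewrite (partition_big (fun p : K * K => [set p.1; p.2]) (mem (int_edges G))) /=.
  apply: eq_bigr => a aG; have [x [y [_ [_ [xy def_a _ _]]]]] := int_edgeP aG.
  rewrite sum1_card -[RHS](_ : #|[set (x, y); (y, x)]| = 2%N); last first.
    by rewrite cards2 xpair_eqE negb_and xy.
  apply: eq_card => -[u v]; rewrite unfold_in /= !inE /= !xpair_eqE.
  apply/andP/orP => [[_ /eqP uv]|[] /andP[/eqP-> /eqP->]]; last 2 first.
  - by rewrite -def_a aG.
  - by rewrite setUC -def_a aG.
  have: x \in [set u; v] by rewrite uv def_a set21.
  have: y \in [set u; v] by rewrite uv def_a set22.
  have: u != v by apply: (@int_edge_neq _ _ _ G); rewrite uv.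
  rewrite !inE => _ /orP[]/eqP ey /orP[]/eqP ex; subst; rewrite ?eqxx ?orbT //;
    by [left|right|rewrite eqxx in xy].
by move=> p; rewrite inE.
Qed.

Implicit Types (Phi : graph V K s -> rat).

(** Since renaming ends does not change an invariant sum, the internal edges may
    be assumed to be a fixed pair of ends; every graph with [m] internal edges
    has [2 m] ordered pairs of ends that could be that pair. *)
Lemma sum_with_edge Phi m (x0 y0 : K) :
  (forall G H, isomorphic G H -> Phi G = Phi H) -> x0 != y0 ->
  (#|K| * #|K|.-1)%N%:R *
    (\sum_(G | admissible m G && ([set x0; y0] \in int_edges G)) Phi G)
  = (m.*2)%:R * \sum_(G | admissible m G) Phi G.
Proof.
move=> inv xy0.
have -> : (m.*2)%:R * \sum_(G | admissible m G) Phi G =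
    \sum_(G | admissible m G)
       \sum_(p : K * K | [set p.1; p.2] \in int_edges G) Phi G.
  rewrite mulr_sumr; apply: eq_bigr => G /and3P[_ _ /eqP <-].
  rewrite -card_darts sumr_const mulr_natl; congr (_ *+ _).
  by apply: eq_card => p; rewrite inE.
rewrite (exchange_big_dep (fun p : K * K => p.1 != p.2)) /=; last first.
  by move=> G p _; apply: int_edge_neq.
rewrite [RHS](eq_bigr (fun=>
  \sum_(G | admissible m G && ([set x0; y0] \in int_edges G)) Phi G)).
  rewrite [RHS]sumr_const -[RHS]mulr_natl; congr (_%:R * _).
  rewrite -[LHS](_ : (\sum_(x : K) \sum_(y : K | x != y) 1 = _)%N).
    by rewrite pair_big_dep /= sum1_card; apply: eq_card.
  rewrite (eq_bigr (fun=> (#|K|.-1)%N)) ?sum_nat_const // => x _.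
  rewrite sum1_card; apply: etrans (cardC1 x); apply: eq_card => y.
  by rewrite !inE eq_sym.
(* A renaming of ends that moves (x0, y0) to (x, y) matches the two sums. *)
move=> [x y] /= xy; have [q [qx qy]] := perm_map2 xy0 xy.
rewrite (reindex_inj (act_inj (relabel_action V K s) (1%g, q))) /=.
apply: eq_big => G; last first.
  by move=> _; apply/inv/isomorphic_sym/isomorphic_relabel.
rewrite -(isomorphic_admissible m (isomorphic_relabel 1%g q G)).
by rewrite -(iso_int (relabel_iso 1%g q G)) imsetU !imset_set1 qx qy.
Qed.

End Darts.

Lemma sum_new_edge (V : finType) e s (P : pred (graph V 'I_(e + 2) s))
    (Phi : graph V 'I_(e + 2) s -> rat) :
  \sum_(H | P H && (new_edge e \in int_edges H)) Phi H =
  \sum_(i : V) \sum_(j : V) \sum_(G : graph V 'I_e s | P (add_edge i j G))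
     Phi (add_edge i j G).
Proof.
pose f (t : V * V * graph V 'I_e s) := add_edge t.1.1 t.1.2 t.2.
have fI : injective f.
  by move=> [[i j] G] [[i' j'] G'] /add_edge_inj /= [-> -> ->].
have fE (H : graph V 'I_(e + 2) s) : (new_edge e \in int_edges H) = (H \in f @: setT).
  apply/idP/imsetP => [/add_edge_onto[i [j [G ->]]]|[t _ ->]].
    by exists (i, j, G).
  exact: new_edge_add.
under eq_bigl => H do rewrite fE andbC.
rewrite big_mkcondr big_imset /=; last by move=> x y _ _; apply: fI.
rewrite -big_mkcondr pair_big pair_big_dep /=.
by apply: eq_bigl => t; rewrite inE.
Qed.

Section Recursion.
Variables (n s : nat).

(** Up to the factor 1/2, [split_sum] and [double_sum] are the transposes of the two
    terms of the recursion, written for arbitrary graphs instead of the chosen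
    representatives. *)
Definition split_sum (F : vgraph n.+1 s -> rat) e (G : graph 'I_n 'I_e s) : rat :=
  \sum_(i < n) \sum_(B : {set _} | B \subset ends_at G i)
    F (vclass (add_edge (old_vertex i) ord_max (split_graph B G))).

Definition double_sum (F : vgraph n s -> rat) e (G : graph 'I_n 'I_e s) : rat :=
  \sum_(i < n) \sum_(j < n | adjacent G i j) F (vclass (add_edge i j G)).

Lemma split_sum_iso F e e' (G : graph 'I_n 'I_e s) (H : graph 'I_n 'I_e' s) :
  iso_invariant F -> isomorphic G H -> split_sum F G = split_sum F H.
Proof.
move=> inv /isomorphicP[f [g iso]].
have [f' fK f'K] := iso_bijV iso; have [g' gK g'K] := iso_bijK iso.
rewrite /split_sum [RHS](reindex f) /=; last by exists f' => ? _.
apply: eq_bigr => i _.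
rewrite [RHS](reindex (fun B : {set _} => g @: B)) /=; last first.
  exists (fun B : {set _} => g' @: B) => B _; rewrite -imset_comp.
    by rewrite (eq_imset _ (gK : g' \o g =1 id)) imset_id.
  by rewrite (eq_imset _ (g'K : g \o g' =1 id)) imset_id.
apply: eq_big => B.
  apply/subsetP/subsetP => h x.
    case/imsetP=> y /h; rewrite inE => /eqP yi ->.
    by rewrite inE (iso_vtx iso) yi.
  move=> xB; have := h (g x) (imset_f g xB); rewrite !inE (iso_vtx iso).
  by case: (vtx G x) => // v /eqP[/(can_inj fK) ->].
move=> _; apply: inv; rewrite -(extend_old f).
rewrite -[X in add_edge _ X (split_graph (g @: _) _)](extend_max f).
exact/isomorphic_add_edge/split_iso.
Qed.

Lemma double_sum_iso F e e' (G : graph 'I_n 'I_e s) (H : graph 'I_n 'I_e' s) :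
  iso_invariant F -> isomorphic G H -> double_sum F G = double_sum F H.
Proof.
move=> inv /isomorphicP[f [g iso]].
have fb := iso_bijV iso.
rewrite /double_sum [RHS](reindex f) /=; last exact: onW_bij.
apply: eq_bigr => i _; rewrite [RHS](reindex f) /=; last exact: onW_bij.
apply: eq_big => [j|j _]; first by rewrite (iso_adjacent iso).
exact/inv/isomorphic_add_edge/iso.
Qed.

Lemma pairing_q_map (x : QV n s) (F : vgraph n.+1 s -> rat) :
  \sum_(i < n) pairing (q_map i x) F
    = pairing x (fun G => 1 / 2 * split_sum F (rep G)).
Proof.
transitivity (\sum_(i < n) pairing x (fun G => 1 / 2 *
    \sum_(B : {set _} | B \subset ends_at (rep G) i)
      F (vclass (add_edge (old_vertex i) ord_max (split_graph B (rep G)))))).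
  apply: eq_bigr => i _.
  rewrite /q_map pairingZ pairing_l_map pairing_s_map -pairingZr.
  apply: eq_pairing => G _; congr (_ * _); apply: eq_bigr => B _.
  congr (F _); apply: vclass_add_edge; exact: rep_vclass.
rewrite -pairing_sumr; apply: eq_pairing => G _.
by rewrite /split_sum mulr_sumr.
Qed.

End Recursion.

Lemma sum_sym_pairs n (r : rel 'I_n) (f : 'I_n -> 'I_n -> rat) :
  symmetric r -> irreflexive r -> (forall i j, f i j = f j i) ->
  \sum_(i < n) \sum_(j < n | (j < i)%N && r i j) f i j
    = 1 / 2 * \sum_(i < n) \sum_(j < n | r i j) f i j.
Proof.
move=> sr ir sf; set S := LHS.
suff -> : \sum_(i < n) \sum_(j < n | r i j) f i j = S + S by field.
have SE : S = \sum_(i < n) \sum_(j < n | (i < j)%N && r j i) f j i.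
  by rewrite /S (exchange_big_dep predT).
rewrite {2}SE /S -big_split /=.
apply: eq_bigr => i _; rewrite (bigID (fun j : 'I_n => (j < i)%N)) /=.
congr (_ + _); first by apply: eq_bigl => j; rewrite andbC.
apply: eq_big => j; last by rewrite sf.
rewrite -leqNgt leq_eqVlt andbC (sr j i).
by case: eqP => [/val_inj ->|]; rewrite ?ir ?andbF.
Qed.

(** The condition [j < i] is not invariant under renaming vertices; half of the sum
    over all ordered pairs is, and it has the same value since the graphs are
    loopless. *)
Lemma pairing_la_maps n s (x : QV n s) (F : vgraph n s -> rat) :
  (forall G, G \in msupp x -> is_loopless (rep G)) ->
  \sum_(i < n) \sum_(j < n | (j < i)%N) pairing (la_map i j x) F
    = pairing x (fun G => 1 / 2 * double_sum F (rep G)).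
Proof.
move=> lx; rewrite -(@eq_pairing _ _ _ (fun G =>
  \sum_(i < n) \sum_(j < n | (j < i)%N)
    if adjacent (rep G) i j then F (vclass (add_edge i j (rep G))) else 0))
  => [|G /lx/looplessP lG].
  rewrite pairing_sumr; apply: eq_bigr => i _; rewrite pairing_sumr.
  by apply: eq_bigr => j _; rewrite pairing_la_map.
rewrite -sum_sym_pairs.
- by apply: eq_bigr => i _; rewrite big_mkcondr.
- exact: adjacent_sym.
- by move=> i; apply/negbTE.
- by move=> i j; rewrite vclass_add_edgeC.
Qed.

(** The marked edge may be the only one between its vertices. If so, it is
    contracted, and the vertex of its second end may be taken to be the last one,
    as each of the [n.+1] choices gives the same sum. If not, it is deleted. *)
Lemma sum_mark_edge n e s m (F : vgraph n.+1 s -> rat) :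
  iso_invariant F ->
  \sum_(H : graph 'I_n.+1 'I_(e + 2) s
       | admissible m.+1 H && (new_edge e \in int_edges H)) F (vclass H) =
  n.+1%:R * (\sum_(G : graph 'I_n 'I_e s | admissible m G) split_sum F G)
  + \sum_(G : graph 'I_n.+1 'I_e s | admissible m G) double_sum F G.
Proof.
move=> inv; rewrite sum_new_edge.
(* The part of the sum with second vertex [v], by adjacency in [G]. *)
pose T (v : 'I_n.+1) (adj : bool) := \sum_(u : 'I_n.+1) \sum_(G : graph 'I_n.+1 'I_e s
   | admissible m.+1 (add_edge u v G) && (adjacent G u v == adj))
     F (vclass (add_edge u v G)).
rewrite exchange_big /=.
have -> : \sum_(v < n.+1) \sum_(u < n.+1)
     \sum_(G : graph 'I_n.+1 'I_e s | admissible m.+1 (add_edge u v G))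
        F (vclass (add_edge u v G)) = \sum_v T v false + \sum_v T v true.
  rewrite -big_split; apply: eq_bigr => v _; rewrite -big_split.
  apply: eq_bigr => u _ /=; rewrite (bigID (fun G => adjacent G u v)) /= addrC.
  by congr (_ + _); apply: eq_bigl => G; case: adjacent.
congr (_ + _); last first.
  rewrite /T /double_sum exchange_big /= [RHS]exchange_big /=.
  apply: eq_bigr => u _; rewrite [RHS](exchange_big_dep predT) //=.
  apply: eq_bigr => v _; apply: eq_bigl => G; rewrite eqb_id andbC.
  case: (boolP (adjacent G u v)) => //= uv; last by rewrite andbF.
  by rewrite admissible_add_parallel ?andbT.
(* Exchanging [v] and the last vertex. *)
have TE v : T v false = T ord_max false.
  rewrite /T (reindex_inj (@perm_inj _ (tperm v ord_max))) /=.
  apply: eq_bigr => u _.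
  pose t := tperm v ord_max.
  rewrite (reindex_inj (act_inj (relabel_action _ _ s) (t, 1%g))) /=.
  have i (G : graph 'I_n.+1 'I_e s) := relabel_iso t 1%g G.
  have iA (G : graph 'I_n.+1 'I_e s) :
      isomorphic (add_edge u ord_max G) (add_edge (t u) v (relabel t 1%g G)).
    by have := isomorphic_add_edge u ord_max (i G); rewrite [t ord_max]tpermR.
  apply: eq_big => G; last by move=> _; apply/inv/isomorphic_sym/iA.
  rewrite -(isomorphic_admissible _ (iA G)); congr (_ && (_ == _)).
  by rewrite -(iso_adjacent (i G)) [t ord_max]tpermR.
rewrite (eq_bigr (fun=> T ord_max false)) // [LHS]sumr_const card_ord -[LHS]mulr_natl.
congr (_ * _); rewrite /T big_ord_recr /= [X in _ + X]big1 ?addr0 => [|G]; last first.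
  by rewrite /admissible loopless_add_edge eqxx !andbF.
rewrite /split_sum exchange_big /=; apply: eq_bigr => i _.
rewrite -/(old_vertex i).
rewrite (eq_bigl (fun G => admissible m (contract i G))) => [|G]; last first.
  by rewrite admissible_contract eqbF_neg.
rewrite (sum_split i) [LHS](eq_bigr (fun G => if admissible m G then
  \sum_(B : {set _} | B \subset ends_at G i)
     F (vclass (add_edge (old_vertex i) ord_max (split_graph B G))) else 0)).
  by rewrite -big_mkcond.
move=> G _; case: (boolP (admissible m G)) => aG.
  apply: eq_bigl => B; case: (boolP (B \subset _)) => //= Bi.
  by rewrite contract_split.
rewrite big_pred0 // => B; case: (boolP (B \subset _)) => //= Bi.
by rewrite contract_split // (negbTE aG).
Qed.

(** * Edges at the last vertex *)

Lemma end_isomorphic_relabel (V K : finType) s (q : {perm K}) (G : graph V K s) :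
  end_isomorphic G (relabel 1%g q G).
Proof.
apply/end_isomorphicP; exists q.
rewrite -(@eq_is_iso _ _ _ _ _ _ _ (1%g : {perm V}) id q q) ?relabel_iso //.
exact: perm1.
Qed.

Lemma admissible_split n e s m (i : 'I_n) (G : graph 'I_n 'I_e s) (B : {set 'I_e}) :
  B \subset ends_at G i -> admissible m G ->
  admissible m.+1 (add_edge (old_vertex i) ord_max (split_graph B G)).
Proof.
by move=> Bi; rewrite -{1}(contract_split Bi) admissible_contract => /andP[].
Qed.

(** Some edge joins the last vertex to another one. It can be deleted if it has a
    parallel edge, and contracted otherwise. *)
Lemma admissible_decomp n e s m (H : graph 'I_n.+2 'I_e s) : admissible m H ->
  exists m' e' (i : 'I_n.+1) (H0 : graph 'I_n.+2 'I_e' s),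
  [/\ m = m'.+1, vclass H = vclass (add_edge (old_vertex i) ord_max H0) &
      adjacent H0 (old_vertex i) ord_max /\ admissible m' H0 \/
      exists (G : graph 'I_n.+1 'I_e' s) (B : {set 'I_e'}),
        [/\ B \subset ends_at G i, H0 = split_graph B G & admissible m' G]].
Proof.
move=> aH; have /and3P[/connectedP cH /looplessP lH /eqP mH] := aH.
have [i ai] : exists i, adjacent H (old_vertex i) ord_max.
  have /connectP[[|b p] /=] := cH ord_max (old_vertex ord0).
    by move=> _ /eqP; rewrite old_neq_max.
  case/andP=> ab _ _; case: (vertexP b) ab => [j|]; last by rewrite (negbTE (lH _)).
  by rewrite adjacent_sym; exists j.
case/adjacentP: (ai) => x [y [xyH xi yM]].
have xy := int_edge_neq xyH.
have [e' ee] : exists e', e = (e' + 2)%N.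
  exists (e - 2)%N; rewrite subnK //.
  have <- : #|[set x; y]| = 2%N by rewrite cards2 xy.
  by rewrite -[X in (_ <= X)%N]card_ord max_card.
subst e.
have new01 : new_end e' ord0 != new_end e' ord_max by rewrite eq_rshift.
have [q [qx qy]] := perm_map2 xy new01.
pose H' := relabel 1%g q H.
have NH' : new_edge e' \in int_edges H'.
  by rewrite /new_edge -qx -qy -imset_set1 -[[set q y]]imset_set1 -imsetU
             (iso_int (relabel_iso _ _ _)).
have [u [v [H0 H'E]]] := add_edge_onto NH'.
have vH' z : vtx H' (q z) = vtx H z.
  rewrite (iso_vtx (relabel_iso _ _ _)); case: (vtx H z) => //= w.
  by rewrite perm1.
have ui : u = old_vertex i.
  by have := vH' x; rewrite qx H'E vtx_add_new xi => -[].
have vM : v = ord_max.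
  by have := vH' y; rewrite qy H'E vtx_add_new yM => -[].
have HE : vclass H = vclass (add_edge (old_vertex i) ord_max H0).
  by rewrite -ui -vM -H'E; apply/end_isomorphic_vclass/end_isomorphic_relabel.
have mE : m = #|int_edges H0|.+1.
  by rewrite -(card_int_add_edge u v) -H'E (iso_card_int (relabel_iso _ _ _)).
have aH' : admissible m (add_edge (old_vertex i) ord_max H0).
  by rewrite -ui -vM -H'E -(isomorphic_admissible _ (isomorphic_relabel _ _ _)).
exists #|int_edges H0|, e', i, H0; split => //; rewrite mE in aH'.
have [adj|nadj] := boolP (adjacent H0 (old_vertex i) ord_max).
  by left; rewrite -(admissible_add_parallel _ adj).
right; exists (contract i H0), (ends_at H0 ord_max).
rewrite split_contract admissible_contract aH' nadj; split=> //.
by rewrite -contract_split_eq split_contract !eqxx.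
Qed.

Lemma admissible_tree_bound n e s m (G : graph 'I_n.+1 'I_e s) :
  admissible m G -> (n <= m)%N.
Proof.
elim: m n e G => [|m IH] [|n] e G // /admissible_decomp[m' [e' [i [H0 []]]]] //.
case=> <- _ [[_ /IH]|[H [B [_ _ /IH]]]] //.
exact: ltnW.
Qed.

(** * The point graph and the recursion *)

(** The end [y] opposite to a label: an external edge has only one free end. *)
Lemma ext_edge_lab (V K : finType) s (G : graph V K s) j :
  exists y, [/\ [set y; lab G j] \in ext_edges G, y != lab G j & vtx G y != None].
Proof.
have [a aE ja] := edge_at G (lab G j).
have aX : a \in ext_edges G.
  move: aE; rewrite inE => /orP[aI|//].
  by have := vtx_int_edge aI ja; rewrite vtx_lab.
have /eqP/cards1P[z az] := free_ext_edge aX.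
have lz : lab G j = z.
  by apply/set1P; rewrite -az inE ja vtx_lab eqxx.
have /eqP/cards2P[x [y [xy def_a]]] := card_edge aE.
have free w : w \in a -> w != lab G j -> vtx G w != None.
  move=> wa; apply: contra => w0; rewrite lz; apply/eqP/set1P.
  by rewrite -az inE wa w0.
have from_pair x' y' : a = [set x'; y'] -> x' != y' -> lab G j = y' ->
    exists y, [/\ [set y; lab G j] \in ext_edges G, y != lab G j & vtx G y != None].
  move=> ea xy' ly; exists x'; rewrite ly -ea; split=> //.
  by apply: free; rewrite ?ly // ea set21.
move: ja; rewrite {1}def_a => /set2P[] lj; last exact: (from_pair x y).
by apply: (from_pair y x) => //; [rewrite setUC | rewrite eq_sym].
Qed.

Lemma loopless_one_vertex e s (G : graph 'I_1 'I_e s) :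
  is_loopless G -> int_edges G = set0.
Proof.
move=> /looplessP lG; apply/setP => a; rewrite inE; apply/negP => aI.
have [x [y [u [v [_ def_a xu yv]]]]] := int_edgeP aI.
have := lG u; case/negP; apply/adjacentP; exists x, y.
by rewrite -def_a xu yv [v]ord1 [u]ord1.
Qed.

Section PointGraph.
Variable s : nat.

Lemma vtx_point_l j : vtx (point_graph s) (lshift s j) = Some ord0.
Proof. by rewrite ffunE -[lshift s j]/(unsplit (inl j)) unsplitK. Qed.

Lemma vtx_point_r j : vtx (point_graph s) (rshift s j) = None.
Proof. by rewrite ffunE -[rshift s j]/(unsplit (inr j)) unsplitK. Qed.

Lemma admissible_point : admissible 0 (point_graph s).
Proof.
apply/and3P; split; last by rewrite cards0.
  by apply/connectedP => u v; rewrite [u]ord1 [v]ord1 connect0.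
by apply/forall_inP => e; rewrite inE.
Qed.

(** Without internal edges, a graph with one vertex is determined up to the names
    of its ends by its labels. *)
Lemma point_end_iso (H : graph 'I_1 'I_(s + s) s) : int_edges H = set0 ->
  end_isomorphic (point_graph s) H.
Proof.
move=> H0; have [p pE] := fin_all_exists (ext_edge_lab H).
have extE a : a \in ext_edges H -> a \in int_edges H :|: ext_edges H.
  by rewrite inE orbC => ->.
have vp j : vtx H (p j) != None by have [] := pE j.
have p_lab i j : p i != lab H j.
  by apply: contraTneq (vp i) => ->; rewrite vtx_lab.
pose g (x : 'I_(s + s)) := match split x with inl j => p j | inr j => lab H j end.
have gl j : g (lshift s j) = p j.
  by rewrite /g -[lshift s j]/(unsplit (inl j)) unsplitK.
have gr j : g (rshift s j) = lab H j.
  by rewrite /g -[rshift s j]/(unsplit (inr j)) unsplitK.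
have pI : injective p.
  move=> i j pij; have [iE _ _] := pE i; have [jE _ _] := pE j.
  have eij : [set p i; lab H i] = [set p j; lab H j].
    by apply: (edge_uniq (extE _ iE) (extE _ jE) (x := p i)); rewrite ?set21 // pij set21.
  have : lab H i \in [set p j; lab H j] by rewrite -eij set22.
  rewrite !inE eq_sym (negbTE (p_lab _ _)) => /eqP; exact: lab_inj.
have gI : injective g.
  move=> x y; case: (split_ordP x) => i ->; case: (split_ordP y) => j ->;
    rewrite ?gl ?gr.
  - by move/pI->.
  - by move/eqP; rewrite (negbTE (p_lab _ _)).
  - by move/esym/eqP; rewrite (negbTE (p_lab _ _)).
  - by move/lab_inj->.
apply/end_isomorphicP; exists g; apply: is_isoI.
- by exists id.
- exact: injF_bij.
- by rewrite H0 /= imset0.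
- apply/eqP; rewrite eq_sym eqEcard; apply/andP; split.
    apply/subsetP => _ /imsetP[_ /imsetP[j _ ->] ->].
    by rewrite imsetU !imset_set1 gl gr; have [] := pE j.
  rewrite card_ext_edges (card_imset _ (imset_inj gI)).
  by rewrite (card_ext_edges (point_graph s)).
- move=> x; case: (split_ordP x) => j ->.
    rewrite gl vtx_point_l; have := vp j; case: (vtx H _) => // v _.
    by rewrite [v]ord1.
  by rewrite gr vtx_point_r vtx_lab.
- by move=> j; rewrite ffunE gr.
Qed.

Lemma point_automorphisms : #|automorphisms (point_graph s)| = 1%N.
Proof.
apply/eqP/cards1P; exists (1%g, 1%g); apply/setP => -[p q]; rewrite !inE /=.
apply/idP/eqP => [iso|[-> ->]]; last first.
  by rewrite (@eq_is_iso _ _ _ _ _ _ _ _ id _ id) ?is_iso_id //; exact: perm1.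
congr pair; apply/permP => x; rewrite perm1; first by rewrite [LHS]ord1 [RHS]ord1.
have qr j : q (rshift s j) = rshift s j.
  by have := iso_lab iso j; rewrite !ffunE.
case: (split_ordP x) => j ->; last exact: qr.
have jE : [set lshift s j; rshift s j] \in ext_edges (point_graph s).
  exact: imset_f.
have := iso_ext iso [set lshift s j; rshift s j]; rewrite jE.
rewrite imsetU !imset_set1 qr => qE.
have PE a : a \in ext_edges (point_graph s) ->
    a \in int_edges (point_graph s) :|: ext_edges (point_graph s).
  by rewrite inE orbC => ->.
have e2 := edge_uniq (PE _ qE) (PE _ jE) (set22 _ _) (set22 _ _).
have : q (lshift s j) \in [set lshift s j; rshift s j] by rewrite -e2 set21.
rewrite !inE => /orP[/eqP //|/eqP]; rewrite -[RHS]qr => /perm_inj/eqP.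
by rewrite eq_lrshift.
Qed.

End PointGraph.

Lemma end_isomorphic_sym n s e e' (G : graph 'I_n 'I_e s)
    (H : graph 'I_n 'I_e' s) :
  end_isomorphic G H -> end_isomorphic H G.
Proof.
have := end_equiv_sym (pregraph_of G) (pregraph_of H).
by rewrite /end_equiv /= => ->.
Qed.

Lemma end_isomorphic_split n s e e' (G : graph 'I_n 'I_e s)
    (H : graph 'I_n 'I_e' s) (i : 'I_n) (B : {set 'I_e}) :
  end_isomorphic G H -> B \subset ends_at G i ->
  exists2 B' : {set 'I_e'}, B' \subset ends_at H i &
    end_isomorphic (split_graph B G) (split_graph B' H).
Proof.
case/end_isomorphicP=> g iso /subsetP Bi; exists (g @: B).
  apply/subsetP => _ /imsetP[x /Bi xi ->]; move: xi.
  by rewrite !inE (iso_vtx iso) => /eqP ->.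
apply/end_isomorphicP; exists g.
rewrite -(@eq_is_iso _ _ _ _ _ _ _ (extend_vertex id) _ g) //; first exact: split_iso.
by move=> v; case: (vertexP v) => [w|]; rewrite ?extend_old ?extend_max.
Qed.

Lemma adjacent_rep_vclass n s e (G : graph 'I_n 'I_e s) u v :
  adjacent (rep (vclass G)) u v = adjacent G u v.
Proof.
by have /end_isomorphicP[g iso] := rep_vclass G; rewrite -(iso_adjacent iso).
Qed.

Section Theta.
Variable s : nat.

Lemma thetaS n k : theta s n.+2 k = (1 / (k + n.+1)%N%:R) *:
  (\sum_(i < n.+1) q_map i (theta s n.+1 k)
   + match k with
     | 0 => 0
     | k'.+1 => \sum_(i < n.+2) \sum_(j < n.+2 | (j < i)%N)
                  la_map i j (theta s n.+2 k')
     end).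
Proof.
rewrite -[(k + n.+1)%N]/(k + n.+1).+1.-1 -subn1 -addnS.
by case: k.
Qed.

Lemma pairing_theta n k F : pairing (theta s n.+2 k) F =
  1 / (k + n.+1)%N%:R *
    (pairing (theta s n.+1 k) (fun G => 1 / 2 * split_sum F (rep G))
     + match k with
       | 0 => 0
       | k'.+1 => \sum_(i < n.+2) \sum_(j < n.+2 | (j < i)%N)
                    pairing (la_map i j (theta s n.+2 k')) F
       end).
Proof.
rewrite thetaS pairingZ pairingD pairing_sum pairing_q_map; congr (_ * (_ + _)).
case: k => [|k]; first exact: pairing0.
by rewrite pairing_sum; apply: eq_bigr => i _; rewrite pairing_sum.
Qed.

Lemma vclass_one_vertex m (G : vgraph 1 s) : admissible m (rep G) ->
  m = 0%N /\ G = vclass (point_graph s).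
Proof.
move=> /and3P[_ lG /eqP mG].
have G0 := loopless_one_vertex lG; rewrite G0 cards0 in mG; split=> //.
have := card_ends (rep G); rewrite G0 cards0 card_ord add0n -addnn => eE.
rewrite -[LHS]vclass_rep; move: (rep G) G0; rewrite eE => H H0.
by apply/esym/end_isomorphic_vclass/point_end_iso.
Qed.

Lemma admissible_vclass n e m (G : graph 'I_n 'I_e s) :
  admissible m (rep (vclass G)) = admissible m G.
Proof. exact/isomorphic_admissible/isomorphic_rep_vclass. Qed.

Lemma pairing_ge0 n (x : QV n s) F :
  (forall G, 0 <= x@_G) -> (forall G, 0 <= F G) -> 0 <= pairing x F.
Proof. by move=> x0 F0; rewrite pairingE; apply: sumr_ge0 => G _; rewrite mulr_ge0. Qed.

Lemma pairing_gt0 n (x : QV n s) F G :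
  (forall G, 0 <= x@_G) -> (forall G, 0 <= F G) -> 0 < x@_G -> 0 < F G ->
  0 < pairing x F.
Proof.
move=> x0 F0 xG FG; have Gx : G \in msupp x by rewrite -mcoeff_neq0 gt_eqF.
rewrite pairingE (bigD1_seq G) //= ?fset_uniq // ltr_pwDl ?mulr_gt0 //.
by apply: sumr_ge0 => H _; apply: mulr_ge0.
Qed.

Lemma pairing_eq0 n (x : QV n s) F :
  (forall G, x@_G != 0 -> F G = 0) -> pairing x F = 0.
Proof.
move=> h; rewrite pairingE big_seq big1 // => G Gx.
by rewrite h ?mulr0 // mcoeff_neq0.
Qed.

Definition supported n m (x : QV n s) :=
  forall G, if admissible m (rep G) then is_true (0 < x@_G) else x@_G = 0.

Lemma supported_ge0 n m (x : QV n s) : supported m x -> forall G, 0 <= x@_G.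
Proof. by move=> sx G; have := sx G; case: ifP => [_ /ltW|_ ->]. Qed.

Lemma supported_neq0 n m (x : QV n s) : supported m x ->
  forall G, x@_G != 0 -> admissible m (rep G).
Proof. by move=> sx G; have := sx G; case: ifP => // _ ->; rewrite eqxx. Qed.

Lemma ler_sum_term (I : finType) (P : pred I) (f : I -> rat) i :
  P i -> (forall j, 0 <= f j) -> f i <= \sum_(j | P j) f j.
Proof. by move=> Pi f0; rewrite (bigD1 i) //= lerDl sumr_ge0. Qed.

Section Coefficient.
Variables (n m : nat) (G : vgraph n.+2 s).
Let F (H : vgraph n.+2 s) : rat := (H == G)%:R.

Let F_ge0 H : 0 <= F H. Proof. exact: ler0n. Qed.

(** The contribution of the maps [q_map] to the coefficient of [G], and then that of
    the maps [la_map]: each is a sum of nonnegative terms, all of them zero unless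
    [G] is admissible, and positive if [G] arises from an admissible graph. *)
Lemma split_coeff (x : QV n.+1 s) : supported m x ->
  let c := pairing x (fun H => 1 / 2 * split_sum F (rep H)) in
  [/\ 0 <= c, ~~ admissible m.+1 (rep G) -> c = 0 &
   forall e i (H : graph 'I_n.+1 'I_e s) (B : {set 'I_e}),
     B \subset ends_at H i -> admissible m H ->
     vclass (add_edge (old_vertex i) ord_max (split_graph B H)) = G -> 0 < c].
Proof.
move=> sx c; have x0 := supported_ge0 sx.
have S0 H : 0 <= 1 / 2 * split_sum F (rep H).
  by rewrite mulr_ge0 //; do 2!apply: sumr_ge0 => ? _.
split=> [|aG|e i H B Bi aH HG]; first exact: pairing_ge0.
  apply: pairing_eq0 => H /(supported_neq0 sx) aH.
  rewrite /split_sum !big1 ?mulr0 // => i _; rewrite big1 // => B Bi.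
  rewrite /F; case: eqP => // HG; case/negP: aG.
  by rewrite -HG admissible_vclass admissible_split.
apply: (pairing_gt0 (G := vclass H) x0 S0).
  by have := sx (vclass H); rewrite admissible_vclass aH.
have [B' Bi' iB] := end_isomorphic_split (end_isomorphic_sym (rep_vclass H)) Bi.
rewrite mulr_gt0 //; pose f j C : rat :=
  F (vclass (add_edge (old_vertex j) ord_max (split_graph C (rep (vclass H))))).
have R0 j : 0 <= \sum_(C : {set _} | C \subset ends_at (rep (vclass H)) j) f j C.
  exact: sumr_ge0.
apply: lt_le_trans (ler_sum_term (P := predT) (i := i) _ R0) => //.
apply: lt_le_trans (ler_sum_term (i := B') Bi' (fun C => F_ge0 _)).
by rewrite /F -(vclass_add_edge _ _ iB) HG eqxx.
Qed.

Lemma double_coeff (x : QV n.+2 s) : supported m x ->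
  let c := \sum_(i < n.+2) \sum_(j < n.+2 | (j < i)%N) pairing (la_map i j x) F in
  [/\ 0 <= c, ~~ admissible m.+1 (rep G) -> c = 0 &
   forall e i (H : graph 'I_n.+2 'I_e s),
     adjacent H (old_vertex i) ord_max -> admissible m H ->
     vclass (add_edge (old_vertex i) ord_max H) = G -> 0 < c].
Proof.
move=> sx c; have x0 := supported_ge0 sx.
have P0 i j : 0 <= pairing (la_map i j x) F.
  by rewrite pairing_la_map; apply: pairing_ge0 => // H; case: ifP.
split=> [|aG|e i H adj aH HG]; first by do 2!apply: sumr_ge0 => ? _.
  rewrite /c big1 // => i _; rewrite big1 // => j _; rewrite pairing_la_map.
  apply: pairing_eq0 => H /(supported_neq0 sx) aH; case: ifP => // adj.
  rewrite /F; case: eqP => // HG; case/negP: aG.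
  by rewrite -HG admissible_vclass admissible_add_parallel.
have R0 (j : 'I_n.+2) : 0 <= \sum_(j' < n.+2 | (j' < j)%N) pairing (la_map j j' x) F.
  exact: sumr_ge0.
apply: lt_le_trans (ler_sum_term (P := predT) (i := ord_max) _ R0) => //.
apply: lt_le_trans (ler_sum_term (i := old_vertex i) _ (P0 ord_max));
  last exact: (ltn_ord i).
rewrite pairing_la_map; have D0 L : 0 <= if adjacent (rep L) ord_max (old_vertex i)
    then F (vclass (add_edge ord_max (old_vertex i) (rep L))) else 0 by case: ifP.
apply: (pairing_gt0 (G := vclass H) x0 D0).
  by have := sx (vclass H); rewrite admissible_vclass aH.
rewrite adjacent_rep_vclass adjacent_sym adj.
by rewrite /F (vclass_add_edge _ _ (rep_vclass H)) vclass_add_edgeC HG eqxx.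
Qed.

End Coefficient.

Lemma theta_supported n k : supported (k + n) (theta s n.+1 k).
Proof.
elim: n k => [|n IHn] k G.
  rewrite addn0; case: ifPn => [/vclass_one_vertex[-> ->]|aG].
    by rewrite mcoeffUU.
  case: k aG => [|k] aG; last by rewrite mcoeff0.
  rewrite mcoeffU; case: eqP aG => // <-.
  by rewrite admissible_vclass admissible_point.
elim: k G => [|k IHk] G; rewrite addnS.
- have [A0 An Ap] := split_coeff G (IHn 0%N).
  rewrite mcoeff_pairing pairing_theta addr0; case: ifPn => [aG|/An ->]; last first.
    by rewrite mulr0.
  rewrite mulr_gt0 ?divr_gt0 ?ltr0n //.
  have [m' [e [i [H [[<-] GE [[_ /admissible_tree_bound]|]]]]]] := admissible_decomp aG.
    by rewrite ltnn.
  case=> L [B' [Bi HE aL]]; apply: Ap Bi aL _.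
  by rewrite -HE -GE vclass_rep.
have [A0 An Ap] := split_coeff G (IHn k.+1).
have := double_coeff G IHk; rewrite addnS => -[D0 Dn Dp].
rewrite mcoeff_pairing pairing_theta; case: ifPn => aG; last first.
  by rewrite An // Dn // addr0 mulr0.
rewrite mulr_gt0 ?divr_gt0 ?ltr0n //.
have [m' [e [i [H [[em] GE [[adj aH]|]]]]]] := admissible_decomp aG.
  rewrite ltr_wpDl //; apply: Dp adj _ _; first by rewrite -addSn em.
  by rewrite -GE vclass_rep.
case=> L [B' [Bi HE aL]]; rewrite ltr_pwDl //; apply: Ap Bi _ _.
  by rewrite em.
by rewrite -HE -GE vclass_rep.
Qed.

Lemma pairing_split_sum n m e (x : QV n.+1 s) (F : vgraph n.+2 s -> rat) :
  iso_invariant F ->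
  (forall F' : vgraph n.+1 s -> rat, iso_invariant F' -> pairing x F' =
     1 / (n.+1`! * e`!)%N%:R *
       \sum_(G : graph 'I_n.+1 'I_e s | admissible m G) F' (vclass G)) ->
  pairing x (fun G => 1 / 2 * split_sum F (rep G)) =
    1 / (n.+1`! * e`!)%N%:R *
      (1 / 2 * \sum_(G : graph 'I_n.+1 'I_e s | admissible m G) split_sum F G).
Proof.
move=> inv ->; last first.
  move=> e1 e2 G H GH; congr (_ * _); apply: split_sum_iso => //.
  apply: isomorphic_trans (isomorphic_rep_vclass G) _.
  exact: isomorphic_trans GH (isomorphic_sym (isomorphic_rep_vclass H)).
congr (_ * _); rewrite mulr_sumr; apply: eq_bigr => G _.
by congr (_ * _); apply/split_sum_iso/isomorphic_rep_vclass.
Qed.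

Lemma pairing_double_sum n m e (x : QV n.+2 s) (F : vgraph n.+2 s -> rat) :
  iso_invariant F -> supported m x ->
  (forall F' : vgraph n.+2 s -> rat, iso_invariant F' -> pairing x F' =
     1 / (n.+2`! * e`!)%N%:R *
       \sum_(G : graph 'I_n.+2 'I_e s | admissible m G) F' (vclass G)) ->
  \sum_(i < n.+2) \sum_(j < n.+2 | (j < i)%N) pairing (la_map i j x) F =
    1 / (n.+2`! * e`!)%N%:R *
      (1 / 2 * \sum_(G : graph 'I_n.+2 'I_e s | admissible m G) double_sum F G).
Proof.
move=> inv sx xE; rewrite pairing_la_maps => [|G]; last first.
  by rewrite -mcoeff_neq0 => /(supported_neq0 sx)/and3P[].
rewrite xE; last first.
  move=> e1 e2 G H GH; congr (_ * _); apply: double_sum_iso => //.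
  apply: isomorphic_trans (isomorphic_rep_vclass G) _.
  exact: isomorphic_trans GH (isomorphic_sym (isomorphic_rep_vclass H)).
congr (_ * _); rewrite mulr_sumr; apply: eq_bigr => G _.
by congr (_ * _); apply/double_sum_iso/isomorphic_rep_vclass.
Qed.

(** The last step of the recursion: [sum_mark_edge] and [sum_with_edge] combined. *)
Lemma mark_edge_identity n m e (F : vgraph n.+2 s -> rat) : iso_invariant F ->
  1 / m.+1%:R *
    (1 / (n.+1`! * e`!)%N%:R *
       (1 / 2 * \sum_(G : graph 'I_n.+1 'I_e s | admissible m G) split_sum F G)
     + 1 / (n.+2`! * e`!)%N%:R *
       (1 / 2 * \sum_(G : graph 'I_n.+2 'I_e s | admissible m G) double_sum F G))
  = 1 / (n.+2`! * (e + 2)`!)%N%:R *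
      \sum_(H : graph 'I_n.+2 'I_(e + 2) s | admissible m.+1 H) F (vclass H).
Proof.
move=> inv; set S1 := \sum_(G | _) split_sum F G.
set S2 := \sum_(G | _) double_sum F G; set U := \sum_(H | _) _.
have new01 : new_end e ord0 != new_end e ord_max by rewrite eq_rshift.
have := @sum_with_edge 'I_n.+2 'I_(e + 2) s (fun H => F (vclass H)) m.+1 _ _
  (fun G H => inv _ _ G H) new01.
rewrite -/U -/(new_edge e) sum_mark_edge // -/S1 -/S2 card_ord => dartE.
have fe : ((e + 2)`! = (e + 2) * (e + 2).-1 * e`!)%N by rewrite addn2 !factS mulnA.
rewrite fe [n.+2`!]factS.
have := fact_gt0 n.+1; have := fact_gt0 e.
move: (n.+1`!) (e`!) => a b b_gt0 a_gt0.
have m0 : m.+1%:R != 0 :> rat by rewrite pnatr_eq0.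
have n0 : n.+2%:R != 0 :> rat by rewrite pnatr_eq0.
have a0 : a%:R != 0 :> rat by rewrite pnatr_eq0 -lt0n.
have b0 : b%:R != 0 :> rat by rewrite pnatr_eq0 -lt0n.
have c0 : (e + 2)%N%:R != 0 :> rat by rewrite pnatr_eq0 addn2.
have d0 : (e + 2).-1%:R != 0 :> rat by rewrite pnatr_eq0 addn2.
move: dartE; rewrite -mul2n !natrM.
move: m.+1%:R n.+2%:R a%:R b%:R (e + 2)%N%:R (e + 2).-1%:R
  m0 n0 a0 b0 c0 d0.
move=> M N A B C D M0 N0 A0 B0 C0 D0 dartE.
have -> : U = C * D * (N * S1 + S2) / (2 * M).
  by rewrite dartE; field.
by field; rewrite ?M0 ?N0 ?A0 ?B0 ?C0 ?D0.
Qed.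

(** In the base case all graphs on the right are isomorphic to the point graph, and
    as it has no automorphisms there are [(2 s)!] of them. *)
Lemma theta_pairing n k e (F : vgraph n.+1 s -> rat) :
  iso_invariant F -> e = (k + n + s).*2 ->
  pairing (theta s n.+1 k) F =
    1 / (n.+1`! * e`!)%N%:R *
      \sum_(H : graph 'I_n.+1 'I_e s | admissible (k + n) H) F (vclass H).
Proof.
elim: n k e F => [|n IHn] k e F inv.
  rewrite addn0 => ->; case: k => [|k].
    rewrite add0n -addnn pairing1.
    have eP (H : graph 'I_1 'I_(s + s) s) :
        admissible 0 H = isomorphic (point_graph s) H.
      apply/idP/idP => [|PH]; last first.
        by rewrite -(isomorphic_admissible 0 PH) admissible_point.
      by case/and3P=> _ /loopless_one_vertex /point_end_iso/end_isomorphicW.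
    rewrite (eq_bigr (fun=> F (vclass (point_graph s)))); last first.
      by move=> H; rewrite eP => /isomorphic_sym/inv.
    rewrite (eq_bigl _ _ eP) sumr_const.
    have := card_isomorphic (point_graph s); rewrite point_automorphisms muln1.
    rewrite !card_ord cardsE => ->.
    rewrite -[X in _ * X]mulr_natl mulrA div1r mulVf ?mul1r //.
    by rewrite pnatr_eq0 -lt0n muln_gt0 !fact_gt0.
  rewrite /= pairing0 big1 ?mulr0 // => H; rewrite -admissible_vclass.
  by case/vclass_one_vertex.
rewrite pairing_theta; elim: k e F inv => [|k IHk] e F inv ->.
  have -> : ((0 + n.+1 + s).*2 = (0 + n + s).*2 + 2)%N by lia.
  rewrite addnS -mark_edge_identity //; congr (_ * (_ + _)).
    by apply: pairing_split_sum => // F' inv'; apply: IHn.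
  (* For k = 0 there is no term to match the sum over doubled edges: it is empty. *)
  rewrite big_pred0 ?mulr0 // => G.
  by apply/negbTE/negP => /admissible_tree_bound; rewrite ltnn.
have -> : ((k.+1 + n.+1 + s).*2 = (k.+1 + n + s).*2 + 2)%N by lia.
rewrite addnS -mark_edge_identity //; congr (_ * (_ + _)).
  by apply: pairing_split_sum => // F' inv'; apply: IHn.
rewrite addSnnS; apply: pairing_double_sum => // [|F' inv'].
  exact: theta_supported.
by rewrite pairing_theta; apply: IHk.
Qed.

End Theta.

Lemma sum_iso_class n s (G : vgraph n s) (x : QV n s) :
  \sum_(H <- iso_class G) x@_H = pairing x (fun H => (viso G H)%:R).
Proof.
under eq_bigr do rewrite mcoeff_pairing.
rewrite -pairing_sumr; apply: eq_pairing => H _; rewrite -mem_iso_class.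
case: (boolP (H \in _)) => HG.
  rewrite (bigD1_seq H) ?fset_uniq //= eqxx big1 ?addr0 // => L.
  by rewrite eq_sym => /negbTE ->.
rewrite big_seq big1 // => L LG; case: eqP => // HL.
by rewrite HL LG in HG.
Qed.

Lemma viso_vclass n s (G : vgraph n s) e (H : graph 'I_n 'I_e s) :
  viso G (vclass H) = isomorphic (rep G) H.
Proof.
have H1 := isomorphic_rep_vclass H; apply/idP/idP => GH.
  exact: isomorphic_trans GH H1.
exact: isomorphic_trans GH (isomorphic_sym H1).
Qed.

Theorem theorem15 (s n k : nat) (n_ge1 : (1 <= n)%N) :
  [/\ forall G : vgraph n s, G \notin Vloopless k -> (theta s n k)@_G = 0,
      forall G : vgraph n s, G \in Vloopless k -> 0 < (theta s n k)@_G
    & forall G : vgraph n s, G \in Vloopless k ->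
        \sum_(H <- iso_class G) (theta s n k)@_H
          = 1 / (symmetry_factor G)%:R].
Proof.
case: n n_ge1 => // n _; have sup := @theta_supported s n k.
split=> G; rewrite Vloopless_admissible => aG.
- by have := sup G; rewrite (negbTE aG).
- by have := sup G; rewrite aG.
have inv : iso_invariant (fun H => (viso G H)%:R : rat).
  move=> e e' H H' HH'; rewrite !viso_vclass; congr (nat_of_bool _)%:R.
  apply/idP/idP => GH; first exact: isomorphic_trans GH HH'.
  exact: isomorphic_trans GH (isomorphic_sym HH').
have eE : tag (repr G) = (k + n + s).*2.
  have /and3P[_ _ /eqP mG] := aG.
  by have := card_ends (rep G); rewrite card_ord mG.
rewrite sum_iso_class (theta_pairing inv eE).
have -> : \sum_(H : graph 'I_n.+1 'I_(tag (repr G)) s | admissible (k + n) H)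
    (viso G (vclass H))%:R
    = #|[set H : graph 'I_n.+1 'I_(tag (repr G)) s | isomorphic (rep G) H]|%:R :> rat.
  rewrite -sum1_card natr_sum big_mkcond [RHS]big_mkcond; apply: eq_bigr => H _.
  rewrite inE viso_vclass.
  case: (boolP (isomorphic _ _)) => [GH|]; last by rewrite if_same.
  by rewrite -(isomorphic_admissible _ GH) aG.
have := card_isomorphic (rep G); rewrite !card_ord => cE.
have := fact_gt0 n.+1; have := fact_gt0 (tag (repr G)) => f1 f2.
have : (0 < n.+1`! * (tag (repr G))`!)%N by rewrite muln_gt0 f1 f2.
rewrite -cE muln_gt0 => /andP[]; rewrite -/(symmetry_factor G) natrM !lt0n => c0 A0.
by field; rewrite !pnatr_eq0 c0 A0.
Qed.
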